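(* Let $S$ be any one of the following sets of forbidden triangles. For the language $\{R,G,X\}$: $S=\{RXX,\ GGX,\ XXX\}$. For the language $\{R,G,X,Y\}$, $S$ is one of: #1 $\{RXX, GYX, YXX\}$; #2 $\{RXX, GYX, YXX, XXX\}$; #3 $\{RXX, GYX, YXX, YYX\}$; #4 $\{RXX, GYX, YXX, YYY\}$; #5 $\{RXX, GYX, YXX, YYX, XXX\}$; #6 $\{RXX, GYX, YXX, XXX, YYY\}$; #7 $\{RXX, GYX, YXX, YYX, YYY\}$; #8 $\{RXX, GYX, YXX, YYX, YYY, XXX\}$; #9 $\{RXX, GYX, YYX, XXX\}$; #10 $\{RXX, GYX, YYX, XXX, YYY\}$; #11 $\{RXX, GGX, YXX, XXX\}$; #12 $\{RXX, GGX, YXX, XXX, YYX\}$; #13 $\{RXX, GGX, YXX, XXX, YYY\}$; #14 $\{RXX, GGX, YXX, YYX, XXX, YYY\}$; #15 $\{RXX, GYX, GGX, YXX, XXX\}$; #16 $\{RXX, GYX, GGX, YXX, XXX, YYX\}$; #17 $\{RXX, GYX, GGX, YXX, XXX, YYY\}$; #18 $\{RXX, GYX, GGX, YXX, YYX, XXX, YYY\}$; #19 $\{RXX, GYX, GGX, YYX, XXX\}$; #20 $\{RXX, GYX, GGX, YYX, XXX, YYY\}$; #21 $\{RXX, RYY, GYX, YYX, XXX\}$; #22 $\{RXX, RYY, GYX, YYX, YXX\}$; #23 $\{RXX, RYY, GYX, YYX, YXX, XXX\}$; #24 $\{RXX, RYY, GYX, YXX, XXX, YYY\}$; #25 $\{RXX,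 RYY, GYX, YXX, YYX, XXX, YYY\}$; #26 $\{RRX, RXX, RYY, GYX, GXX, YYX, XXX\}$; #27 $\{RRY, RRX, GYX, GXX, GYY, YYX, YXX, XXX, YYY\}$. Let $\mathcal M_S$ be the Fraïssé limit of $Forb_c(S)$. Then the automorphism group $\mathrm{Aut}(\mathcal M_S)$ is simple.
   Context: The language $\mathcal L$ consists of binary relation symbols, each interpreted as a symmetric irreflexive relation. An $\mathcal L$-structure is complete if any two distinct elements are related by exactly one relation of $\mathcal L$. A triangle is a complete structure on three points; it is specified by the unordered multiset of its three edge relations (e.g. $RXX$ is a triangle with one edge in $R$ and two edges in $X$). For a set $S$ of triangles, $Forb_c(S)$ is the class of all finite complete $\mathcal L$-structures that embed no triangle from $S$. For each $S$ listed, $Forb_c(S)$ is an amalgamation class (a class of finite structures closed under isomorphism and substructures, with countably many isomorphism types, the joint embedding property and the amalgamation property), and its Fraïssé limit $\mathcal M_S$ is the unique countable homogeneous structure (every isomorphism between finite substructures extends to an automorphism) whose class of finite substructures up to isomorphism is $Forb_c(S)$. *)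

(* Defs.v *)
From HB Require Import structures.
From Stdlib Require List.
From mathcomp Require Import all_boot.
From mathcomp Require Import boolp classical_sets cardinality.

Set Implicit Arguments.
Unset Strict Implicit.
Unset Printing Implicit Defensive.

Local Open Scope classical_set_scope.

(* [L] is the set of binary relation symbols; the carrier may be empty. *)
Record lstructure (L : Type) := LStructure {
  carrier :> Type;
  rel_of : L -> carrier -> carrier -> Prop;
  rel_of_sym : forall l x y, rel_of l x y -> rel_of l y x;
  rel_of_irr : forall l x, ~ rel_of l x x
}.

Section Structures.
Variable L : Type.
Implicit Types A B M : lstructure L.

Definition complete A : Prop :=
  forall x y : A, x <> y -> exists! l : L, rel_of l x y.

Definition embeds A B : Prop :=
  exists f : A -> B,
    injective f /\ forall l x y, rel_of l (f x) (f y) <-> rel_of l x y.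

Record isomorphism A B := Isomorphism {
  iso_fun :> A -> B;
  iso_inv : B -> A;
  iso_funK : cancel iso_fun iso_inv;
  iso_invK : cancel iso_inv iso_fun;
  iso_rel : forall l x y, rel_of l (iso_fun x) (iso_fun y) <-> rel_of l x y
}.

Definition isomorphic A B : Prop := inhabited (isomorphism A B).

Definition substructure M (D : set M) : lstructure L :=
  @LStructure L D (fun l x y => rel_of l (val x) (val y))
    (fun l x y => @rel_of_sym L M l (val x) (val y))
    (fun l x => @rel_of_irr L M l (val x)).

(* The order of the three labels is immaterial: permuting them gives
   isomorphic three-point structures below. *)
Definition triangle : Type := (L * L * L)%type.

Definition triangle_edge (t : triangle) (i j : 'I_3) : option L :=
  let: (a, b, c) := t in
  match nat_of_ord i, nat_of_ord j with
  | 0, 1 | 1, 0 => Some a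
  | 1, 2 | 2, 1 => Some b
  | 0, 2 | 2, 0 => Some c
  | _, _ => None
  end.

Lemma triangle_edge_sym t l i j :
  triangle_edge t i j = Some l -> triangle_edge t j i = Some l.
Proof. by case: t => [[a b] c]; case: i => [[|[|[|i]]] ?]; case: j => [[|[|[|j]]] ?]. Qed.

Lemma triangle_edge_irr t l i : ~ triangle_edge t i i = Some l.
Proof. by case: t => [[a b] c]; case: i => [[|[|[|i]]] ?]. Qed.

Definition triangle_structure (t : triangle) : lstructure L :=
  @LStructure L 'I_3 (fun l i j => triangle_edge t i j = Some l)
    (@triangle_edge_sym t) (@triangle_edge_irr t).

Definition Forb_c (S : seq triangle) A : Prop :=
  [/\ finite_set [set: A], complete A
    & forall t, List.In t S -> ~ embeds (triangle_structure t) A].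

Definition homogeneous M : Prop :=
  forall D E : set M, finite_set D -> finite_set E ->
  forall f : isomorphism (substructure D) (substructure E),
  exists g : isomorphism M M, forall x : substructure D, g (val x) = val (f x).

Definition is_fraisse_limit (K : lstructure L -> Prop) M : Prop :=
  [/\ countable [set: M], homogeneous M
    & forall A, K A <->
        exists2 D : set M, finite_set D & isomorphic A (substructure D)].

End Structures.

Section Automorphisms.
Variables (L : Type) (M : lstructure L).

Definition Aut : Type := isomorphism M M.
Implicit Types f g h : Aut.

Lemma aut_eq f g : (forall x, f x = g x) -> f = g.
Proof.
case: f g => f f' fK f'K fR [g g' gK g'K gR] /= /funext fg.
case: _ / fg gK g'K gR => gK g'K gR.
have fg' : f' = g' by apply/funext => x; rewrite -{1}(g'K x) fK.
case: _ / fg' gK g'K gR => gK g'K gR.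
by congr Isomorphism; apply: Prop_irrelevance.
Qed.

Definition aut1 : Aut :=
  @Isomorphism L M M id id (fun=> erefl) (fun=> erefl) (fun _ _ _ => iff_refl _).

Lemma aut_mul_rel f g l x y :
  rel_of l ((f \o g) x) ((f \o g) y) <-> rel_of l x y.
Proof. exact: iff_trans (iso_rel f _ _ _) (iso_rel g _ _ _). Qed.

Definition aut_mul f g : Aut :=
  Isomorphism (can_comp (@iso_funK _ _ _ f) (@iso_funK _ _ _ g))
    (can_comp (@iso_invK _ _ _ g) (@iso_invK _ _ _ f)) (@aut_mul_rel f g).

Lemma aut_inv_rel f l x y :
  rel_of l (iso_inv f x) (iso_inv f y) <-> rel_of l x y.
Proof. by rewrite -(iso_rel f) !iso_invK. Qed.

Definition aut_inv f : Aut :=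
  Isomorphism (@iso_invK _ _ _ f) (@iso_funK _ _ _ f) (@aut_inv_rel f).

Lemma aut_mulA : associative aut_mul.
Proof. by move=> f g h; apply: aut_eq. Qed.
Lemma aut_mul1 : left_id aut1 aut_mul.
Proof. by move=> f; apply: aut_eq. Qed.
Lemma aut_mul1r : right_id aut1 aut_mul.
Proof. by move=> f; apply: aut_eq. Qed.
Lemma aut_mulV : left_inverse aut1 aut_inv aut_mul.
Proof. by move=> f; apply: aut_eq => x /=; rewrite iso_funK. Qed.
Lemma aut_mulrV : right_inverse aut1 aut_inv aut_mul.
Proof. by move=> f; apply: aut_eq => x /=; rewrite iso_invK. Qed.

HB.instance Definition _ := gen_eqMixin Aut.
HB.instance Definition _ := gen_choiceMixin Aut.
HB.instance Definition _ :=
  isGroup.Build Aut aut_mulA aut_mul1 aut_mul1r aut_mulV aut_mulrV.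

End Automorphisms.

Section SimpleGroup.
Local Open Scope group_scope.

Definition normal_subgroup (G : groupType) (N : set G) : Prop :=
  [/\ N 1, forall x y, N x -> N y -> N (x * y), forall x, N x -> N x^-1
    & forall x g, N x -> N (x ^ g)].

Definition simple_group (G : groupType) : Prop :=
  (exists x : G, x <> 1) /\
  forall N : set G, normal_subgroup N -> N = [set 1] \/ N = [set: G].

End SimpleGroup.

Module RGX.

Inductive symbol : Set := R | G | X.

Definition S : seq (triangle symbol) := [:: (R,X,X); (G,G,X); (X,X,X)].

End RGX.

Module RGXY.

Inductive symbol : Set := R | G | X | Y.

Definition catalogue : seq (seq (triangle symbol)) := [::
  [:: (R,X,X); (G,Y,X); (Y,X,X)];
  [:: (R,X,X); (G,Y,X); (Y,X,X); (X,X,X)];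
  [:: (R,X,X); (G,Y,X); (Y,X,X); (Y,Y,X)];
  [:: (R,X,X); (G,Y,X); (Y,X,X); (Y,Y,Y)];
  [:: (R,X,X); (G,Y,X); (Y,X,X); (Y,Y,X); (X,X,X)];
  [:: (R,X,X); (G,Y,X); (Y,X,X); (X,X,X); (Y,Y,Y)];
  [:: (R,X,X); (G,Y,X); (Y,X,X); (Y,Y,X); (Y,Y,Y)];
  [:: (R,X,X); (G,Y,X); (Y,X,X); (Y,Y,X); (Y,Y,Y); (X,X,X)];
  [:: (R,X,X); (G,Y,X); (Y,Y,X); (X,X,X)];
  [:: (R,X,X); (G,Y,X); (Y,Y,X); (X,X,X); (Y,Y,Y)];
  [:: (R,X,X); (G,G,X); (Y,X,X); (X,X,X)];
  [:: (R,X,X); (G,G,X); (Y,X,X); (X,X,X); (Y,Y,X)];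
  [:: (R,X,X); (G,G,X); (Y,X,X); (X,X,X); (Y,Y,Y)];
  [:: (R,X,X); (G,G,X); (Y,X,X); (Y,Y,X); (X,X,X); (Y,Y,Y)];
  [:: (R,X,X); (G,Y,X); (G,G,X); (Y,X,X); (X,X,X)];
  [:: (R,X,X); (G,Y,X); (G,G,X); (Y,X,X); (X,X,X); (Y,Y,X)];
  [:: (R,X,X); (G,Y,X); (G,G,X); (Y,X,X); (X,X,X); (Y,Y,Y)];
  [:: (R,X,X); (G,Y,X); (G,G,X); (Y,X,X); (Y,Y,X); (X,X,X); (Y,Y,Y)];
  [:: (R,X,X); (G,Y,X); (G,G,X); (Y,Y,X); (X,X,X)];
  [:: (R,X,X); (G,Y,X); (G,G,X); (Y,Y,X); (X,X,X); (Y,Y,Y)];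
  [:: (R,X,X); (R,Y,Y); (G,Y,X); (Y,Y,X); (X,X,X)];
  [:: (R,X,X); (R,Y,Y); (G,Y,X); (Y,Y,X); (Y,X,X)];
  [:: (R,X,X); (R,Y,Y); (G,Y,X); (Y,Y,X); (Y,X,X); (X,X,X)];
  [:: (R,X,X); (R,Y,Y); (G,Y,X); (Y,X,X); (X,X,X); (Y,Y,Y)];
  [:: (R,X,X); (R,Y,Y); (G,Y,X); (Y,X,X); (Y,Y,X); (X,X,X); (Y,Y,Y)];
  [:: (R,R,X); (R,X,X); (R,Y,Y); (G,Y,X); (G,X,X); (Y,Y,X); (X,X,X)];
  [:: (R,R,Y); (R,R,X); (G,Y,X); (G,X,X); (G,Y,Y); (Y,Y,X); (Y,X,X); (X,X,X); (Y,Y,Y)]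
].

End RGXY.

(* Main.v *)
(** In each of the classes two structures can be amalgamated over a common part
    by choosing every new edge from a short priority list: the label [top] when
    no forbidden triangle results, else [alt], and in a single case a third
    label.  This yields a stationary independence relation on the limit in the
    sense of Tent and Ziegler, which for binary structures is a relation between
    pairs of points over a base.

    Let [g] be a nontrivial element of a normal subgroup.  Every non-algebraic
    type has a realization moved by [g].  For a generic automorphism [u], some
    realization [y] of each type is sent by the commutator [[g, u]] to a point at
    a label produced by the amalgamation rule, and commuting once more with a
    generic automorphism makes [y] independent from its image.  If [f] is this
    double commutator, the products of three conjugates of [f] with conjugators
    in a given open set are dense in some open set; building two such products
    [a] and [b] simultaneously by a back and forth gives [a h = b] for an
    arbitrary automorphism [h]. *)

Require Import Defs.
From mathcomp Require Import all_boot.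
From mathcomp Require Import boolp classical_sets cardinality.

Set Implicit Arguments.
Unset Strict Implicit.
Unset Printing Implicit Defensive.

Local Open Scope classical_set_scope.

(** * Finite sets, amalgamation rules and generic structures *)

Lemma finite_set_ind (T : Type) (P : set T -> Prop) :
  P set0 -> (forall x A, finite_set A -> P A -> P (x |` A)) ->
  forall A, finite_set A -> P A.
Proof.
move=> P0 PU A /(@finite_seqP {classic T})[s ->].
elim: s => [|x s IHs]; first by rewrite set_nil.
rewrite (_ : [set` x :: s] = x |` [set` s]).
  apply: PU => //; exact: (@finite_seq {classic T}).
apply/seteqP; split=> y /=; rewrite inE; first by case/orP=> [/eqP|]; [left|right].
by case=> [->|->]; rewrite ?eqxx ?orbT.
Qed.

(* [comp x y] is the label given to an edge [ab] when the only common point [c]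
   has [ac] labelled [x] and [bc] labelled [y]; over several common points the
   label of least rank is taken.  [ok] holds of the allowed triangles. *)
Record amalgam_rule (L : Type) := AmalgamRule {
  ok : L -> L -> L -> bool;
  top : L;
  alt : L;
  comp : L -> L -> L;
  rank : L -> nat;
  free_label := fun l => l = top \/ exists x y, l = comp x y;
  ok_swap : forall x y z, ok x y z = ok y x z;
  ok_rot : forall x y z, ok x y z = ok y z x;
  ok_top_top : forall x, ok top top x;
  ok_top_alt : forall x, ok top alt x;
  top_neq_alt : top <> alt;
  comp_sym : forall x y, comp x y = comp y x;
  comp_top : forall x, comp top x = top;
  rank_le_top : forall x, rank x <= rank top;
  rank_inj : forall x y, free_label x -> free_label y -> rank x = rank y -> x = y;
  comp_free : forall x y, free_label x -> free_label y -> comp x y = top;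
  ok_comp : forall x y, ok x y (comp x y);
  ok_comp_le : forall x y x' y' z, ok x x' z -> ok y y' z ->
    rank (comp x' y') <= rank (comp x y) -> ok x y (comp x' y');
  rank_comp : forall x y z t, ok y z t ->
    rank (comp x z) <= rank (comp (comp x y) t);
  ok_comp_top : forall x y y' z, ok y y' z -> comp x y' = top ->
    ok (comp x y) top z;
  ok_comp_base : forall x y y' z, ok y y' z -> ok (comp x y) (comp x y') z;
  ok_comp_comp : forall x y y' x1 y1 y1' w z,
    ok x x1 w -> ok y y1 w -> ok y' y1' w -> ok y y' z -> ok y1 y1' z ->
    rank (comp x y) <= rank (comp x1 y1) ->
    rank (comp x1 y1') <= rank (comp x y') ->
    ok (comp x y) (comp x1 y1') z
}.

(* [col x x] is unconstrained. *)
Record generic_structure (L : Type) (K : amalgam_rule L) (M : lstructure L)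
    (col : M -> M -> L) : Prop := GenericStructure {
  colC : forall x y, col x y = col y x;
  rel_col : forall l x y, rel_of l x y <-> x <> y /\ col x y = l;
  col_ok : forall x y z, x <> y -> y <> z -> x <> z ->
    ok K (col x z) (col y z) (col x y);
  col_ext : forall (C : set M) (e : M -> L), finite_set C ->
    (forall c d, C c -> C d -> c <> d -> ok K (e c) (e d) (col c d)) ->
    exists2 y, ~ C y & forall c, C c -> col y c = e c;
  col_hom : forall (C : set M) (p : M -> M), finite_set C ->
    (forall c d, C c -> C d -> c <> d -> p c <> p d /\ col (p c) (p d) = col c d) ->
    exists u : Aut M, forall c, C c -> u c = p c
}.

Definition fixes (L : Type) (M : lstructure L) (u : Aut M) (C : set M) :=
  forall c, C c -> u c = c.

Definition aut_conj (L : Type) (M : lstructure L) (f u : Aut M) : Aut M :=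
  aut_mul (aut_inv u) (aut_mul f u).

(** * The independence relation of an amalgamation rule *)

Section Independence.
Variables (L : Type) (K : amalgam_rule L) (M : lstructure L) (col : M -> M -> L).
Hypothesis genM : generic_structure K col.
Implicit Types (C D E B A X Y Z : set M) (u v f g h k : Aut M) (a b c d x y z : M).

Let colC' := colC genM.

Lemma aut_inj u x y : u x = u y -> x = y.
Proof. exact: (can_inj (@iso_funK _ _ _ u)). Qed.

Lemma col_aut u x y : x <> y -> col (u x) (u y) = col x y.
Proof.
move=> xy; have /(iso_rel u) : rel_of (col x y) x y by apply/(rel_col genM).
by case/(rel_col genM).
Qed.

Lemma fixes_sub u C D : D `<=` C -> fixes u C -> fixes u D.
Proof. by move=> DC uC c /DC /uC. Qed.

Lemma fixes_inv u C : fixes u C -> fixes (aut_inv u) C.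
Proof. by move=> uC c Cc /=; rewrite -{1}(uC c Cc) iso_funK. Qed.

Lemma fixes_mul u v C : fixes u C -> fixes v C -> fixes (aut_mul u v) C.
Proof. by move=> uC vC c Cc /=; rewrite vC // uC. Qed.

Lemma aut_conj_fixed f v E x : fixes v E -> E x -> E (f x) -> aut_conj f v x = f x.
Proof. by move=> vE Ex Efx /=; rewrite vE //; apply: (fixes_inv vE). Qed.

(** The label that the rule gives to [ab] over [C], as a relation: a candidate of least rank. Since
    [top K] has the largest rank, minimality is asked only against the points of [C]. *)
Definition free_col C a b l :=
  (l = top K \/ exists2 c, C c & l = comp K (col a c) (col b c)) /\
  forall c, C c -> rank K l <= rank K (comp K (col a c) (col b c)).

(** Equality is excluded outside the base because [col] carries no information on the diagonal. *)
Definition ind C a b :=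
  [\/ C a, C b | a <> b /\ free_col C a b (col a b)].

Lemma free_col_ex C a b : exists l, free_col C a b l.
Proof.
pose cand l := l = top K \/ exists2 c, C c & l = comp K (col a c) (col b c).
have ex : exists n, `[< exists2 l, cand l & rank K l = n >].
  by exists (rank K (top K)); apply/asboolP; exists (top K) => //; left.
case: (ex_minnP ex) => n /asboolP[l cl ln] min; exists l; split=> // c Cc.
by rewrite ln; apply/min/asboolP; eexists; last reflexivity; right; exists c.
Qed.

Lemma free_col_label C a b l : free_col C a b l -> free_label K l.
Proof. by case=> -[->|[c _ ->]] _; [left|right; do 2 eexists]. Qed.

(** Stationarity: the types over [C] determine the candidates, so both labels have the same least
    rank, and [rank_inj] applies to free labels. *)
Lemma free_col_uniq C a b a' b' l l' :
  (forall c, C c -> col a' c = col a c) -> (forall c, C c -> col b' c = col b c) ->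
  free_col C a b l -> free_col C a' b' l' -> l = l'.
Proof.
move=> aa bb fl fl'; apply: (@rank_inj _ K).
- exact: free_col_label fl.
- exact: free_col_label fl'.
case: fl fl' => [o m] [o' m']; apply/eqP; rewrite eqn_leq; apply/andP; split.
  case: o' => [->|[c Cc ->]]; first exact: rank_le_top.
  by rewrite aa // bb // m.
case: o => [->|[c Cc ->]]; first exact: rank_le_top.
by rewrite -(aa c) // -(bb c) // m'.
Qed.

Lemma ind_baseL C a b : C a -> ind C a b.
Proof. by constructor 1. Qed.

Lemma ind_baseR C a b : C b -> ind C a b.
Proof. by constructor 2. Qed.

Lemma ind_sym C a b : ind C a b -> ind C b a.
Proof.
case=> [?|?|[ab [o m]]]; [exact: ind_baseR|exact: ind_baseL|constructor 3].
split; [exact/nesym|split=> [|c Cc]]; rewrite colC'; last by rewrite comp_sym m.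
by case: o => [|[c Cc ->]]; [left|right; exists c => //; rewrite comp_sym].
Qed.

Lemma ind_refl C a : ind C a a -> C a.
Proof. by case=> // -[]. Qed.

Lemma ind_neq C a b : ~ C a -> ind C a b -> a <> b.
Proof. by move=> nCa; case=> // [Cb ab|[]//]; apply: nCa; rewrite ab. Qed.

Lemma ind_free C a b : ~ C a -> ~ C b -> ind C a b -> free_col C a b (col a b).
Proof. by move=> nCa nCb; case=> // -[]. Qed.

Lemma ind_stationary C a b a' b' :
  ~ C a -> ~ C b -> ~ C a' -> ~ C b' ->
  (forall c, C c -> col a' c = col a c) -> (forall c, C c -> col b' c = col b c) ->
  ind C a b -> ind C a' b' -> col a' b' = col a b.
Proof.
move=> Ca Cb Ca' Cb' aa bb /(ind_free Ca Cb) f1 /(ind_free Ca' Cb') f2.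
exact/esym/(free_col_uniq aa bb f1 f2).
Qed.

(** If the label of [ad] comes from a base point [c], then [rank_comp] for the triangle [dbc] bounds
    the candidate of [c] by that of [d]. Hence [d] adds no constraint to those of [C]. *)
Lemma comp_base C a b d : ~ C d -> ~ C b -> b <> d ->
  free_col C a d (col a d) ->
  comp K (col a d) (col b d) = top K \/
  exists2 c, C c & rank K (comp K (col a c) (col b c)) <=
                   rank K (comp K (col a d) (col b d)).
Proof.
move=> Cd Cb bd [[e|[c Cc e]] _]; first by left; rewrite e comp_top.
right; exists c => //; rewrite e; apply: rank_comp; rewrite (colC' b d).
by apply: (col_ok genM) => [/esym|bc|dc] //; [apply: Cb; rewrite bc|apply: Cd; rewrite dc].
Qed.

(* Transitivity and monotonicity of independence at once: a base may be enlarged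
   by points that are themselves independent of [a]. *)
Lemma ind_base C E a b : C `<=` E -> (forall d, E d -> ind C a d) ->
  ind E a b <-> ind C a b.
Proof.
move=> CE aE.
have [Ca|nCa] := pselect (C a).
  by split=> _; apply: ind_baseL => //; apply: CE.
have nEa : ~ E a by move=> /aE /ind_refl.
have [Cb|nCb] := pselect (C b).
  by split=> _; apply: ind_baseR => //; apply: CE.
have [Eb|nEb] := pselect (E b).
  by split=> _; [exact: aE|exact: ind_baseR].
have key d : E d -> comp K (col a d) (col b d) = top K \/
    exists2 c, C c & rank K (comp K (col a c) (col b c)) <=
                     rank K (comp K (col a d) (col b d)).
  move=> Ed; have [Cd|nCd] := pselect (C d); first by right; exists d.
  apply: comp_base => //; first by move=> bd; apply: nEb; rewrite bd.
  by apply: ind_free => //; exact: aE.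
split=> i; constructor 3; split; try exact: ind_neq i.
  have [o m] := ind_free nEa nEb i; split; last by move=> c /CE; apply: m.
  case: o => [|[d Ed e]]; first by left.
  case: (key d Ed) => [e'|[c Cc le]]; first by left; rewrite e.
  right; exists c => //; apply: (@rank_inj _ K).
  - by rewrite e; right; do 2 eexists.
  - by right; do 2 eexists.
  by apply/eqP; rewrite eqn_leq m ?e //=; apply: CE.
have [o m] := ind_free nCa nCb i; split.
  by case: o => [|[c /CE Ec e]]; [left|right; exists c].
move=> d Ed; case: (key d Ed) => [->|[c Cc]]; first exact: rank_le_top.
exact/leq_trans/m.
Qed.

Lemma ind_aut C u a b : ind C a b -> ind (u @` C) (u a) (u b).
Proof.
have [Ca|nCa] := pselect (C a); first by move=> _; apply: ind_baseL; exists a.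
have [Cb|nCb] := pselect (C b); first by move=> _; apply: ind_baseR; exists b.
case=> // -[ab [o m]]; constructor 3; split; first by move=> /aut_inj.
have ac c : C c -> a <> c by move=> Cc e; apply: nCa; rewrite e.
have bc c : C c -> b <> c by move=> Cc e; apply: nCb; rewrite e.
rewrite col_aut //; split=> [|_ [c Cc <-]]; last first.
  by rewrite !col_aut; auto.
case: o => [|[c Cc e]]; [by left|right; exists (u c); first by exists c].
by rewrite !col_aut; auto.
Qed.

Lemma ind_fixes C u a b : fixes u C -> ind C a b -> ind C (u a) (u b).
Proof.
move=> uC /(ind_aut u); suff -> : u @` C = C by [].
by apply/seteqP; split=> [_ [c Cc <-]|c Cc]; [rewrite uC|exists c => //; rewrite uC].
Qed.

Lemma move2 C a b a' b' : finite_set C -> ~ C a -> ~ C b -> a <> b ->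
  ~ C a' -> ~ C b' -> a' <> b' ->
  (forall c, C c -> col a' c = col a c) -> (forall c, C c -> col b' c = col b c) ->
  col a' b' = col a b ->
  exists2 u, fixes u C & u a = a' /\ u b = b'.
Proof.
move=> finC Ca Cb ab Ca' Cb' ab' aa bb eab.
pose p x := if pselect (x = a) then a' else if pselect (x = b) then b' else x.
have pa : p a = a' by rewrite /p; case: pselect.
have pb : p b = b'.
  by rewrite /p; case: pselect => /= [e|?]; [case: ab|case: pselect].
have pC c : C c -> p c = c.
  rewrite /p => Cc; case: pselect => /= [e|?]; first by case: Ca; rewrite -e.
  by case: pselect => // e; case: Cb; rewrite -e.
have neq x y : ~ C x -> C y -> x <> y by move=> Cx Cy e; apply: Cx; rewrite e.
have fin : finite_set (C `|` [set a; b]).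
  by rewrite !finite_setU; split=> //; split; exact: finite_set1.
have [|u up] := @col_hom _ _ _ _ genM _ p fin.
  move=> c d [Cc|[]->] [Cd|[]->] cd; rewrite ?pa ?pb ?pC //; split;
    by [apply: neq|apply/nesym/neq|rewrite colC' ?aa ?bb // colC'
       |rewrite ?aa ?bb|apply/nesym|rewrite colC' eab colC'].
by exists u; [move=> c Cc; rewrite up ?pC //; left|rewrite !up ?pa ?pb//; right; [right|left]].
Qed.

Lemma move1 C a a' : finite_set C -> ~ C a -> ~ C a' ->
  (forall c, C c -> col a' c = col a c) ->
  exists2 u, fixes u C & u a = a'.
Proof.
move=> finC Ca Ca' aa.
pose p x := if pselect (x = a) then a' else x.
have pa : p a = a' by rewrite /p; case: pselect.
have pC c : C c -> p c = c.
  by rewrite /p => Cc; case: pselect => // e; case: Ca; rewrite -e.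
have neq x y : ~ C x -> C y -> x <> y by move=> Cx Cy e; apply: Cx; rewrite e.
have fin : finite_set (C `|` [set a]).
  by rewrite finite_setU; split=> //; exact: finite_set1.
have [|u up] := @col_hom _ _ _ _ genM _ p fin.
  move=> c d [Cc|->] [Cd|->] cd; rewrite ?pa ?pC //; split.
  - exact/nesym/neq.
  - by rewrite colC' aa // colC'.
  - exact: neq.
  - exact: aa.
by exists u; [move=> c Cc; rewrite up ?pC //; left|rewrite up ?pa//; right].
Qed.

(** The type of [a] over [C] is extended to [B] by giving each new edge its free label; [col_ext]
    realizes it once all triangles are seen to be allowed. *)
Lemma ind_ex1 C B a : finite_set C -> finite_set B ->
  exists2 u, fixes u C & forall b, B b -> ind C (u a) b.
Proof.
move=> finC finB.
have [Ca|nCa] := pselect (C a).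
  by exists (aut1 M) => // b _; apply: ind_baseL.
have /choice[fr frP] := free_col_ex C a.
pose e x := if pselect (C x) then col a x else fr x.
have eC c : C c -> e c = col a c by rewrite /e => Cc; case: pselect.
have eB b : ~ C b -> e b = fr b by rewrite /e => Cb; case: pselect.
have neq x y : ~ C x -> C y -> x <> y by move=> Cx Cy E; apply: Cx; rewrite E.
(* One vertex in the base: the free label at [d] ranks no higher than the candidate of [c], which is
   what [ok_comp_le] asks. *)
have okC c d : C c -> ~ C d -> ok K (col a c) (fr d) (col c d).
  move=> Cc Cd; have [o m] := frP d.
  have le := m _ Cc.
  suff : ok K (col a c) (col d c) (fr d) by rewrite (colC' c d) ok_rot ok_rot ok_swap.
  case: o le => [->|[c' Cc' ->]] le.
    have <- : comp K (col a c) (col d c) = top K; last exact: ok_comp.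
    apply: (@rank_inj _ K); [by right; do 2 eexists|by left|].
    by apply/eqP; rewrite eqn_leq rank_le_top.
  have [<-|cc'] := pselect (c = c'); first exact: ok_comp.
  apply: (@ok_comp_le _ _ _ _ _ _ (col c c')) => //.
    rewrite !(colC' a); apply: (col_ok genM); rewrite //; exact/nesym/neq.
  rewrite !(colC' d); apply: (col_ok genM); rewrite //; exact/nesym/neq.
have okB b d : ~ C b -> ~ C d -> b <> d -> ok K (fr b) (fr d) (col b d).
  move=> Cb Cd bd; have [o m] := frP b; have [o' m'] := frP d.
  have okt c : C c -> ok K (col b c) (col d c) (col b d).
    by move=> Cc; apply: (col_ok genM) => //; exact: neq.
  have topE c x : C c -> rank K (top K) <= rank K (comp K (col a c) (col x c)) ->
      comp K (col a c) (col x c) = top K.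
    move=> Cc le; apply: (@rank_inj _ K); [by right; do 2 eexists|by left|].
    by apply/eqP; rewrite eqn_leq rank_le_top.
  (* If one label is [top K], minimality makes its candidate at the base point of the other [top K]
     as well. If the labels come from distinct base points, the two minimality statements are the
     rank hypotheses of [ok_comp_comp]. *)
  case: o m => [->|[c Cc ->]] m; case: o' m' => [->|[c' Cc' ->]] m'.
  - exact: ok_top_top.
  - rewrite ok_swap; apply: (@ok_comp_top _ _ _ _ (col b c')).
      by rewrite ok_swap; exact: okt.
    exact: topE (m _ Cc').
  - apply: (@ok_comp_top _ _ _ _ (col d c)); first exact: okt.
    exact: topE (m' _ Cc).
  have [<-|cc'] := pselect (c = c'); first by apply: ok_comp_base; exact: okt.
  have okc x : ~ C x -> ok K (col x c) (col x c') (col c c').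
    move=> Cx; rewrite !(colC' x); apply: (col_ok genM) => //; exact/nesym/neq.
  by apply: (@ok_comp_comp _ _ _ _ _ _ (col b c') _ (col c c')); auto.
have fin : finite_set (C `|` B) by rewrite finite_setU.
have [|y Cy ye] := @col_ext _ _ _ _ genM _ e fin.
  move=> c d _ _ cd; have [Cc|Cc] := pselect (C c); have [Cd|Cd] := pselect (C d).
  - rewrite !eC // !(colC' a); apply: (col_ok genM) => //; exact/nesym/neq.
  - by rewrite eC // eB //; exact: okC.
  - by rewrite eB // eC // ok_swap (colC' c d); exact: okC.
  - by rewrite !eB //; exact: okB.
have nCy : ~ C y by move=> ?; apply: Cy; left.
have yC c : C c -> col y c = col a c by move=> Cc; rewrite ye ?eC //; left.
have [u uC ua] := move1 finC nCa nCy yC.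
exists u => // b Bb; rewrite ua.
have [Cb|nCb] := pselect (C b); first exact: ind_baseR.
constructor 3; split; first by move=> yb; apply: Cy; rewrite yb; right.
rewrite ye; last by right.
rewrite eB //; have [o m] := frP b; split=> [|c Cc]; last by rewrite yC // m.
by case: o => [|[c Cc ->]]; [left|right; exists c; rewrite ?yC].
Qed.

(** Points are treated one at a time, each made free over [C] together with the images already
    placed; [ind_base] then shrinks the base to [C]. *)
Lemma ind_ex (C B Z : set M) : finite_set C -> finite_set B -> finite_set Z ->
  exists2 u, fixes u C & forall z b, Z z -> B b -> ind C (u z) b.
Proof.
move=> finC finB; elim/finite_set_ind: Z / => [|z Z finZ [u uC uZ]].
  by exists (aut1 M).
have finY : finite_set (C `|` u @` Z).
  by rewrite finite_setU; split=> //; apply: finite_image.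
have [v vCY vz] := ind_ex1 (u z) finY finB.
have vu x : Z x -> v (u x) = u x by move=> Zx; apply: vCY; right; exists x.
exists (aut_mul v u) => [|x b].
  by apply: fixes_mul => //; apply: fixes_sub vCY => c; left.
move=> [->|Zx] Bb /=; last by rewrite vu //; exact: uZ.
apply/ind_sym/(@ind_base _ (C `|` u @` Z)) => [c|d [Cd|[x' xZ <-]]|]; first by left.
- exact: ind_baseR.
- exact/ind_sym/uZ.
exact/ind_sym/vz.
Qed.

Lemma ind_baseW C E a b : C `<=` E -> (forall d, E d -> ind C a d) ->
  ind C a b -> ind E a b.
Proof. by move=> CE /(ind_base b CE) []. Qed.

Lemma ind_trans C E a b : C `<=` E -> (forall d, E d -> ind C a d) ->
  ind E a b -> ind C a b.
Proof. by move=> CE /(ind_base b CE) []. Qed.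

(** * Automorphisms that move every type freely *)

Lemma image_autK u C : iso_inv u @` (u @` C) = C.
Proof.
apply/seteqP; split=> [_ [_ [c Cc <-] <-]|c Cc]; first by rewrite iso_funK.
by exists (u c); [exists c|rewrite iso_funK].
Qed.

Lemma image_autVK u C : u @` (iso_inv u @` C) = C.
Proof. exact: image_autK (aut_inv u) C. Qed.

Lemma ind_push C u a b : ind (iso_inv u @` C) a b -> ind C (u a) (u b).
Proof. by move/(ind_aut u); rewrite image_autVK. Qed.

Lemma ind_pull C u a b : ind C (u a) (u b) -> ind (iso_inv u @` C) a b.
Proof. by move/(ind_aut (aut_inv u)); rewrite /= !iso_funK. Qed.

(* The elements that "move almost maximally" in the terminology of Tent and Ziegler. *)
Definition moves_freely f := forall C a, finite_set C ->
  exists2 u, fixes u C & ind C (u a) (f (u a)).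

Ltac fin := repeat first [assumption | exact: finite_set1 | exact: finite_set0
  | apply: finite_image | (rewrite finite_setU; split)].

(** First [a] is moved away from [B], then freely over [C] and [B] together. The second move
    preserves the independence from [B], so the base shrinks to [C]. *)
Lemma moves_freely_away f C B a : moves_freely f -> finite_set C -> finite_set B ->
  exists u, [/\ fixes u C, forall b, B b -> ind C (u a) b & ind C (u a) (f (u a))].
Proof.
move=> mf finC finB; have [u uC uB] := ind_ex1 a finC finB.
have [|v vCB va] := mf (C `|` B) (u a); first by fin.
have vC : fixes v C by apply: fixes_sub vCB => c; left.
have vuB b : B b -> ind C (v (u a)) b.
  by move=> Bb; rewrite -(vCB b); [exact/ind_fixes/uB|right].
exists (aut_mul v u); split=> //; first exact: fixes_mul.
apply: ind_trans va => [c|d [Cd|Bd]]; [by left|exact: ind_baseR|exact: vuB].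
Qed.

(** A point [y] independent from [f y] over the preimage of [C] is found, and [f y] is the required
    realization. The base is exchanged for [C] through the union [E] of the two, from which [y] and
    [f y] are each independent over their own base. *)
Lemma moves_freely_inv f : moves_freely f -> moves_freely (aut_inv f).
Proof.
move=> mf C a finC; pose f' : M -> M := iso_inv f.
pose E := f' @` C `|` C.
have [||u [uC uB uf]] := @moves_freely_away f (f' @` C) (E `|` f' @` E) (f' a) mf.
- by fin.
- by fin.
exists (aut_mul f (aut_mul u (aut_inv f))) => [c Cc|] /=.
  by rewrite uC ?iso_invK //; exists c.
rewrite iso_funK; set y := u (f' a) in uB uf *.
apply: (@ind_trans _ E) => [c|d Ed|]; first by right.
  by rewrite -(iso_invK f d); apply/ind_push/uB; right; exists d.
apply/ind_sym/(@ind_baseW (f' @` C)) => [c|d Ed|//]; first by left.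
by apply: uB; left.
Qed.

Lemma moves_freely_conj f v : moves_freely f -> moves_freely (aut_conj f v).
Proof.
move=> mf C a finC; have [|u uC uf] := mf (v @` C) (v a); first by fin.
exists (aut_conj u v) => [c Cc|] /=.
  by rewrite uC ?iso_funK //; exists c.
rewrite iso_invK -(image_autK v C) -[X in ind _ _ X]/(iso_inv v _).
exact: (ind_aut (aut_inv v)).
Qed.

Lemma moves_freely_set f C B Z : moves_freely f ->
  finite_set C -> finite_set B -> finite_set Z ->
  exists u, [/\ fixes u C, forall x b, Z x -> B b -> ind C (u x) b
    & forall x y, Z x -> Z y -> ind C (u x) (f (u y))].
Proof.
move=> mf finC + finZ; elim/finite_set_ind: Z / finZ B => [|z Z finZ IH] B finB.
  by exists (aut1 M).
have [|u [uC uB uf]] := IH (B `|` f @` C); first by fin.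
pose Y := u @` Z; pose f' : M -> M := iso_inv f.
have finY : finite_set Y by fin.
have [||v [vCY vB vf]] := @moves_freely_away f (C `|` Y)
    (B `|` f @` Y `|` f' @` Y `|` f' @` C) (u z) mf; try by fin.
have vC : fixes v C by apply: fixes_sub vCY => c; left.
have vu x : Z x -> v (u x) = u x by move=> Zx; apply: vCY; right; exists x.
have YB x b : Y x -> B b -> ind C x b by move=> [x' Zx <-] Bb; apply: uB => //; left.
have YC x c : Y x -> C c -> ind C x (f c).
  by move=> [x' Zx <-] Cc; apply: uB => //; right; exists c.
have Yf x y : Y x -> Y y -> ind C x (f y) by move=> [x' Zx <-] [y' Zy <-]; apply: uf.
have trans d y : (forall x, Y x -> ind C d x) -> ind (C `|` Y) d y -> ind C d y.
  by move=> dY; apply: ind_trans => [c|x [Cx|Yx]]; [left|exact: ind_baseR|exact: dY].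
have yB b : B b -> ind C (v (u z)) b.
  move=> Bb; apply/ind_sym/trans => [x Yx|]; first exact/ind_sym/YB.
  by apply/ind_sym/vB; left; left; left.
have yf x : Y x -> ind C (v (u z)) (f x).
  move=> Yx; apply/ind_sym/trans => [y Yy|]; first exact/ind_sym/Yf.
  by apply/ind_sym/vB; left; left; right; exists x.
(* Pulled back by [f], this concerns the new point and the preimage of [x], which the new point was
   made to avoid; the base passes through [C], [Y] and the preimage of [C]. *)
have fy x : Y x -> ind C x (f (v (u z))).
  move=> Yx; rewrite -[x](iso_invK f) -/f'; apply: ind_push.
  apply: (@ind_trans _ (C `|` Y `|` f' @` C)) => [c|d|]; first by right.
    case=> [[Cd|Yd]|]; last exact: ind_baseR.
      by apply: ind_pull; rewrite iso_invK; exact: YC.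
    by apply: ind_pull; rewrite iso_invK; exact: Yf.
  apply/ind_sym/(@ind_baseW (C `|` Y)) => [c|d [CYd|Cd]|]; first by left.
  - exact: ind_baseR.
  - by apply: vB; right.
  - by apply: vB; left; right; exists x.
exists (aut_mul v u); split=> /= [|x b|x y].
- exact: fixes_mul.
- by case=> [->|Zx] Bb; [exact: yB|rewrite vu //; apply: YB => //; exists x].
case=> [->|Zx] [->|Zy]; rewrite ?(vu _ Zx) ?(vu _ Zy).
- by apply/ind_sym/trans => [w Yw|]; [exact/ind_sym/fy|exact/ind_sym].
- by apply: yf; exists y.
- by apply: fy; exists x.
- exact: uf.
Qed.

(** A first conjugation frees the image of [Z] from [Z]. A second one, by an [s] fixing [E] and [Z],
    acts on that image alone as far as [Z] is concerned and frees it from [B]. *)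
Lemma conj_pushed f E Z B : moves_freely f ->
  finite_set E -> finite_set B -> finite_set Z ->
  exists2 v, fixes v E &
    forall z b, Z z -> Z b \/ B b -> ind E (aut_conj f v z) b.
Proof.
move=> mf finE finB finZ.
have [u [uE _ uf]] := moves_freely_set mf finE (finite_set0 M) finZ.
pose f' := aut_conj f u.
have f'Z x y : Z x -> Z y -> ind E (f' x) y.
  move=> Zx Zy; rewrite -[y](iso_funK u).
  by apply/(ind_fixes (fixes_inv uE))/ind_sym/uf.
have [|||s sEZ sB] := @ind_ex (E `|` Z) B (f' @` Z); try by fin.
have sE : fixes s E by apply: fixes_sub sEZ => c; left.
have s'EZ := fixes_inv sEZ.
have conjE x : Z x -> aut_conj f (aut_mul u (aut_inv s)) x = s (f' x).
  by move=> Zx /=; have /= -> : aut_inv s x = x by apply: s'EZ; right.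
exists (aut_mul u (aut_inv s)); first exact/fixes_mul/fixes_inv.
have sfZ x y : Z x -> Z y -> ind E (s (f' x)) y.
  by move=> Zx Zy; rewrite -(sEZ y); [exact/ind_fixes/f'Z|right].
move=> z b Zz; rewrite conjE // => -[Zb|Bb]; first exact: sfZ.
apply: (@ind_trans _ (E `|` Z)) => [c|d [Ed|Zd]|]; first by left.
- exact: ind_baseR.
- exact: sfZ.
by apply: sB => //; exists z.
Qed.
(** * Products of three conjugates *)

Lemma fixes_out u C a : fixes u C -> ~ C a -> ~ C (u a).
Proof. by move=> uC Ca Cua; apply: Ca; rewrite -(aut_inj (uC _ Cua)). Qed.

Lemma col_fixes u C a c : fixes u C -> ~ C a -> C c -> col (u a) c = col a c.
Proof.
by move=> uC Ca Cc; rewrite -{1}(uC c Cc) col_aut // => e; apply: Ca; rewrite e.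
Qed.

(** Some [y] of the type of [a] over [X] is independent from [f y]. By stationarity the pairs
    [(a, x)] and [(y, f y)] have the same type over the whole set, and homogeneity supplies the
    conjugator. *)
Lemma conj_realize f X A a x :
  moves_freely f -> finite_set X -> finite_set A ->
  ~ X a -> ~ (f @` X) x -> (forall y, X y -> col x (f y) = col a y) ->
  (forall b, (f @` X) b \/ A b -> ind X a b) ->
  (forall b, X b \/ A b -> ind (f @` X) x b) ->
  ind (X `|` f @` X `|` A) a x ->
  exists2 u, fixes u (X `|` f @` X `|` A) & aut_conj f u a = x.
Proof.
set F := X `|` f @` X `|` A; pose f' : M -> M := iso_inv f.
move=> mf finX finA Xa fXx colx aF xF iax.
have finF : finite_set F by fin.
(* Avoiding the preimages of [X] and [A] makes [f y] independent of [X] and [A] over the image of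
   [X]. *)
have [||u0 [uX uB uf]] := @moves_freely_away f X
    (f @` X `|` A `|` (f' @` X `|` f' @` A)) a mf; try by fin.
set y := u0 a in uB uf; have Xy : ~ X y by exact: fixes_out.
have FE c : F c -> [\/ X c, (f @` X) c | A c].
  by rewrite /F => -[[?|?]|?]; [constructor 1|constructor 2|constructor 3].
have Fa : ~ F a by move=> /FE[//|?|?]; apply: Xa; apply: ind_refl; apply: aF; [left|right].
have yF b : F b -> ind X y b.
  by move=> /FE[Xb|Xb|Ab]; [exact: ind_baseR|apply: uB; left; left|apply: uB; left; right].
have Fy : ~ F y by move=> Fy; apply: Xy; apply: ind_refl; exact: yF.
have Fx : ~ F x by move=> /FE[?|//|?]; apply: fXx; apply: ind_refl; apply: xF; [left|right].
have fyF c : X c \/ A c -> ind (f @` X) (f y) c.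
  move=> XAc; rewrite -(iso_invK f c); apply/ind_aut/uB; right.
  by case: XAc => ?; [left|right]; exists c.
have fXfy : ~ (f @` X) (f y) by move=> [z Xz /aut_inj e]; apply: Xy; rewrite -e.
have Ffy : ~ F (f y).
  by move=> /FE[?|//|?]; apply: fXfy; apply: ind_refl; apply: fyF; [left|right].
have cola c : F c -> col y c = col a c.
  move=> Fc; have [Xc|Xc] := pselect (X c); first exact: (col_fixes uX).
  apply: (@ind_stationary X) => //.
  - by move=> d; exact: (col_fixes uX).
  - by apply: aF; case/FE: Fc => // ?; [left|right].
  - exact: yF.
have colfy c : F c -> col (f y) c = col x c.
  have [[z Xz <-] _|Xc Fc] := pselect ((f @` X) c).
    rewrite colx // col_aut; first exact: (col_fixes uX).
    by move=> e; apply: Xy; rewrite e.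
  have XAc : X c \/ A c by case/FE: Fc => // ?; [left|right].
  apply: (@ind_stationary (f @` X)) => //; [|exact: xF|exact: fyF].
  move=> _ [z Xz <-]; rewrite colx // col_aut; first exact: (col_fixes uX).
  by move=> e; apply: Xy; rewrite e.
have iyfy : ind F y (f y).
  by apply: ind_baseW uf => // c Xc; left; left.
have [|u uF [ua ux]] := move2 finF Fa Fx (ind_neq Fa iax) Fy Ffy (ind_neq Fy iyfy) cola colfy.
  exact: (@ind_stationary F).
by exists u => //=; rewrite ua -ux iso_funK.
Qed.

(* The two conditions survive adding an arbitrary pair to the first and the last
   set, which is what lets the composite [f3 f2 f1] be prescribed freely. *)
Definition good_chain (f1 f2 f3 : Aut M) X0 :=
  let X1 := f1 @` X0 in let X2 := f2 @` X1 in let X3 := f3 @` X2 in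
  (forall x y, X3 x -> X1 y -> ind X0 x y) /\
  (forall x y, X0 x -> X2 y -> ind X3 x y).

(* The hypothesis [gen] of this lemma is obtained in [chain_extend] by conjugating
   the chain over its two ends, which contain [A]. *)
Lemma chain_extend_indep f1 f2 f3 k X0 A a :
  let X1 := f1 @` X0 in let X2 := f2 @` X1 in let X3 := f3 @` X2 in
  moves_freely f1 -> moves_freely f2 -> moves_freely f3 ->
  finite_set X0 -> A `<=` X0 -> A `<=` X3 ->
  good_chain f1 f2 f3 X0 -> (forall x, X0 x -> k x = f3 (f2 (f1 x))) -> ~ X0 a ->
  (forall x y, X1 x \/ X2 x -> y = a \/ y = k a -> ind (X0 `|` X3) x y) ->
  exists v1 v2 v3, let f1' := aut_conj f1 v1 in let f2' := aut_conj f2 v2 in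
    let f3' := aut_conj f3 v3 in
    [/\ fixes v1 A, fixes v2 A, fixes v3 A, good_chain f1' f2' f3' (X0 `|` [set a])
      & forall x, (X0 `|` [set a]) x -> k x = f3' (f2' (f1' x))].
Proof.
move=> X1 X2 X3 mf1 mf2 mf3 finX0 AX0 AX3 [N1 N2] kX X0a gen.
have finX1 : finite_set X1 by fin.
have finX2 : finite_set X2 by fin.
have finX3 : finite_set X3 by fin.
have finA : finite_set A := sub_finite_set AX0 finX0.
pose b := k a.
have k3 x : X0 x -> X3 (k x).
  by move=> ?; rewrite kX //; exists (f2 (f1 x)) => //; exists (f1 x) => //; exists x.
have X3b : ~ X3 b.
  move=> [_ [_ [x X0x <-] <-]]; rewrite -kX // => /aut_inj e.
  by apply: X0a; rewrite -e.
have i01 y x : y = a \/ y = b -> X1 x -> ind X0 y x.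
  move=> yab X1x; apply/ind_sym/(@ind_trans _ (X0 `|` X3)) => [c|d [Xd|Xd]|]; first by left.
  - exact: ind_baseR.
  - exact/ind_sym/N1.
  - by apply: gen => //; left.
have i32 y x : y = a \/ y = b -> X2 x -> ind X3 y x.
  move=> yab X2x; apply/ind_sym/(@ind_trans _ (X0 `|` X3)) => [c|d [Xd|Xd]|]; first by right.
  - exact/ind_sym/N2.
  - exact: ind_baseR.
  - by apply: gen => //; right.
pose U := X0 `|` X1 `|` X2 `|` X3 `|` [set a; b].
have finU : finite_set U by fin.
(* The orbit of [a] is to be [a], [x1], [x2], [b], with [x1] and [x2] as free as their types over
   [X1] and [X2] permit; [conj_realize] then adjusts each factor. *)
have [s1 sX1 s1U] := ind_ex1 (f1 a) finX1 finU; set x1 := s1 (f1 a) in s1U.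
have [|s2 sX2 s2U] := @ind_ex1 X2 (U `|` [set x1]) (f2 x1) finX2; first by fin.
set x2 := s2 (f2 x1) in s2U.
have X1x1 : ~ X1 x1.
  by apply: fixes_out => // -[x X0x /aut_inj e]; apply: X0a; rewrite -e.
have X2x2 : ~ X2 x2.
  by apply: fixes_out => // -[x X1x /aut_inj e]; apply: X1x1; rewrite -e.
have neq C y z : C y -> ~ C z -> z <> y by move=> Cy Cz e; apply: Cz; rewrite e.
have col1 x : X0 x -> col x1 (f1 x) = col a x.
  move=> X0x; have fX1a : ~ X1 (f1 a).
    by move=> [z Xz /aut_inj e]; apply: X0a; rewrite -e.
  rewrite (col_fixes sX1) //; last by exists x.
  by rewrite col_aut //; exact: neq X0a.
have col2 x : X1 x -> col x2 (f2 x) = col x1 x.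
  move=> X1x; have fX2x : ~ X2 (f2 x1).
    by move=> [z Xz /aut_inj e]; apply: X1x1; rewrite -e.
  rewrite (col_fixes sX2) //; last by exists x.
  by rewrite col_aut //; exact: neq X1x1.
have col3 x : X2 x -> col b (f3 x) = col x2 x.
  move=> [_ [x' X0x <-] <-]; rewrite col2; last by exists x'.
  by rewrite col1 // -kX // col_aut //; exact: neq X0a.
have s1X x : X0 x \/ X2 x \/ X3 x \/ x = a \/ x = b -> ind X1 x1 x.
  by move=> h; apply: s1U; rewrite /U/=; tauto.
have s2X x : X0 x \/ X1 x \/ X3 x \/ x = a \/ x = b \/ x = x1 -> ind X2 x2 x.
  by move=> h; apply: s2U; rewrite /U/=; tauto.
have lift X Y y x : (forall c, X c \/ A c \/ c = y -> ind Y x c) ->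
    ind (X `|` Y `|` A) y x.
  move=> xi; apply/ind_sym/(@ind_baseW Y) => [c Yc|d [[Xd|Yd]|Ad]|].
  - by left; right.
  - by apply: xi; left.
  - exact: ind_baseR.
  - by apply: xi; right; left.
  - by apply: xi; right; right.
have [|||v1 v1F e1] := @conj_realize f1 X0 A a x1 mf1 finX0 finA X0a X1x1 col1.
- by move=> z [|/AX0]; [apply: i01; left|exact: ind_baseR].
- by move=> z [|/AX0] ?; apply: s1X; tauto.
- by apply: lift => c [|[/AX0|->]] *; apply: s1X; tauto.
have [|||v2 v2F e2] := @conj_realize f2 X1 A x1 x2 mf2 finX1 finA X1x1 X2x2 col2.
- by move=> z [|/AX0] ?; apply: s1X; tauto.
- by move=> z [|/AX0] ?; apply: s2X; tauto.
- by apply: lift => c [|[/AX0|->]] *; apply: s2X; tauto.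
have [|||v3 v3F e3] := @conj_realize f3 X2 A x2 b mf3 finX2 finA X2x2 X3b col3.
- by move=> z [|/AX0] ?; apply: s2X; tauto.
- by move=> z [|/AX3]; [apply: i32; right|exact: ind_baseR].
- rewrite (setUC X2); apply: ind_sym; apply: lift => c [|[/AX0|->]] *; apply: s2X; tauto.
have conjE f v (X : set M) x : fixes v (X `|` f @` X `|` A) -> X x -> aut_conj f v x = f x.
  by move=> vF Xx; apply: (aut_conj_fixed vF); left; [left|right; exists x].
have imE f v (X : set M) y z : fixes v (X `|` f @` X `|` A) -> aut_conj f v y = z ->
    aut_conj f v @` (X `|` [set y]) = f @` X `|` [set z].
  move=> vF e; rewrite image_setU image_set1 e; congr (_ `|` _).
  by apply/seteqP; split=> _ [x Xx <-]; exists x; rewrite // (conjE f v X).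
exists v1, v2, v3 => f1' f2' f3'.
have fA v (X Y : set M) : fixes v (X `|` Y `|` A) -> fixes v A.
  by apply: fixes_sub => c; right.
split; [exact: fA v1F|exact: fA v2F|exact: fA v3F| |]; last first.
  move=> x [X0x|->]; last by rewrite e1 e2 e3.
  have X1x : X1 (f1 x) by exists x.
  have X2x : X2 (f2 (f1 x)) by exists (f1 x).
  by rewrite kX // /f1' (conjE f1 v1 X0) // /f2' (conjE f2 v2 X1) // /f3' (conjE f3 v3 X2).
rewrite /good_chain (imE _ _ _ _ _ v1F e1) (imE _ _ _ _ _ v2F e2) (imE _ _ _ _ _ v3F e3).
(* The halves of [good_chain] are mirror images: for the second one, [X3], [X2], [X0] replace [X0],
   [X1], [X3], and [b] and [a] exchange places. *)
have main Y0 Y1 Y3 c d y1 : ~ Y0 c ->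
    (forall x y, Y3 x \/ x = d -> Y1 y -> ind Y0 x y) ->
    (forall x, Y1 x -> ind Y0 c x) ->
    (forall x, Y0 x \/ Y3 x \/ x = c \/ x = d -> ind Y1 y1 x) ->
    forall x y, (Y3 `|` [set d]) x -> (Y1 `|` [set y1]) y -> ind (Y0 `|` [set c]) x y.
  move=> _ dY cY y1Y.
  have base x y : Y3 x \/ x = d -> Y1 y -> ind (Y0 `|` [set c]) x y.
    move=> Yx Yy; apply/ind_sym/(@ind_baseW Y0) => [z|z [Yz|->]|]; first by left.
    - exact: ind_baseR.
    - exact/ind_sym/cY.
    - exact/ind_sym/dY.
  move=> x y Yx [Yy|->]; first exact: base.
  apply: (@ind_trans _ (Y0 `|` [set c] `|` Y1)) => [z|z [Yz|Yz]|]; first by left.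
  - exact: ind_baseR.
  - exact: base.
  apply/ind_sym/(@ind_baseW Y1) => [z|z [[Yz|->]|Yz]|]; first by right.
  - by apply: y1Y; left.
  - by apply: y1Y; right; right; left.
  - exact: ind_baseR.
  - by apply: y1Y; right; case: Yx; [left|right; right].
split.
  apply: main => //.
  - by move=> x y [Xx|->] Xy; [exact: N1|apply: i01 => //; right].
  - by move=> x; apply: i01; left.
  - by move=> x h; apply: s1X; tauto.
apply: main => //.
- by move=> x y [Xx|->] Xy; [exact: N2|apply: i32 => //; left].
- by move=> x; apply: i32; right.
- by move=> x h; apply: s2X; tauto.
Qed.
Lemma aut_conjM f u v : aut_conj (aut_conj f u) v = aut_conj f (aut_mul u v).
Proof. exact: aut_eq. Qed.

Lemma aut_conj1 f : aut_conj f (aut1 M) = f.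
Proof. exact: aut_eq. Qed.

Lemma aut_conjV f v : aut_conj (aut_inv f) v = aut_inv (aut_conj f v).
Proof. exact: aut_eq. Qed.

Lemma image_fixes u C : fixes u C -> u @` C = C.
Proof.
move=> uC; apply/seteqP; split=> [_ [c Cc <-]|c Cc]; first by rewrite uC.
by exists c; rewrite ?uC.
Qed.

Lemma image_eq f g C : (forall c, C c -> f c = g c) -> f @` C = g @` C.
Proof. by move=> fg; apply/seteqP; split=> _ [c Cc <-]; exists c; rewrite ?fg. Qed.

Lemma image_chain f1 f2 f3 k X : (forall x, X x -> k x = f3 (f2 (f1 x))) ->
  f3 @` (f2 @` (f1 @` X)) = k @` X.
Proof.
move=> kX; apply/seteqP; split=> [_ [_ [_ [x Xx <-] <-] <-]|_ [x Xx <-]].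
  by exists x; rewrite ?kX.
by rewrite kX //; do !eexists.
Qed.

(** An [s] fixing both ends of the chain moves the two middle sets away from [a] and [k a].
    Conjugating all three factors by the inverse of [s] preserves the composite on [X0]. *)
Lemma chain_extend f1 f2 f3 k X0 A a :
  moves_freely f1 -> moves_freely f2 -> moves_freely f3 ->
  finite_set X0 -> A `<=` X0 -> A `<=` k @` X0 ->
  good_chain f1 f2 f3 X0 -> (forall x, X0 x -> k x = f3 (f2 (f1 x))) ->
  exists v1 v2 v3, let f1' := aut_conj f1 v1 in let f2' := aut_conj f2 v2 in
    let f3' := aut_conj f3 v3 in
    [/\ fixes v1 A, fixes v2 A, fixes v3 A, good_chain f1' f2' f3' (X0 `|` [set a])
      & forall x, (X0 `|` [set a]) x -> k x = f3' (f2' (f1' x))].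
Proof.
move=> mf1 mf2 mf3 finX0 AX0 Ak good kX.
have [X0a|X0a] := pselect (X0 a).
  exists (aut1 M), (aut1 M), (aut1 M); rewrite !aut_conj1.
  rewrite (_ : X0 `|` [set a] = X0) //.
  by apply/seteqP; split=> [x [//|->]|x]; [|left].
have X3E := image_chain kX.
have [|||s sX sI] := @ind_ex (X0 `|` k @` X0) [set a; k a]
    (f1 @` X0 `|` f2 @` (f1 @` X0)); try by fin.
have sX0 : fixes s X0 by apply: fixes_sub sX; exact: subsetUl.
have skX0 : fixes s (k @` X0) by apply: fixes_sub sX; exact: subsetUr.
have sA : fixes (aut_inv s) A by apply/fixes_inv/fixes_sub/sX0.
have conj_im f X : aut_conj f (aut_inv s) @` (s @` X) = s @` (f @` X).
  apply/seteqP; split=> [_ [_ [x Xx <-] <-]|_ [_ [x Xx <-] <-]].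
    by exists (f x); [exists x|rewrite /= iso_funK].
  by exists (s x); [exists x|rewrite /= iso_funK].
have s1 : aut_conj f1 (aut_inv s) @` X0 = s @` (f1 @` X0).
  by rewrite -{1}(image_fixes sX0) conj_im.
have mfs f : moves_freely f -> moves_freely (aut_conj f (aut_inv s)).
  exact: moves_freely_conj.
have s2 := conj_im f2 (f1 @` X0); have s3 := conj_im f3 (f2 @` (f1 @` X0)).
rewrite X3E (image_fixes skX0) in s3.
have [|||||v1 [v2 [v3 [v1A v2A v3A good' kX']]]] := @chain_extend_indep _ _ _
    k X0 A a (mfs _ mf1) (mfs _ mf2) (mfs _ mf3) finX0 AX0.
- by rewrite s1 s2 s3.
- move: good; rewrite /good_chain s1 s2 s3 X3E => -[N1 N2].
  split=> [x _ Xx [y Xy <-]|x _ Xx [y Xy <-]].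
    by rewrite -(skX0 x) //; apply/(ind_fixes sX0)/N1.
  by rewrite -(sX0 x) //; apply/(ind_fixes skX0)/N2.
- move=> x X0x /=; rewrite !iso_funK.
  have -> : iso_inv s x = x by have := fixes_inv sX0 X0x.
  by rewrite -kX // skX0 //; exists x.
- exact: X0a.
- rewrite s1 s2 s3 => x y [[x' Xx <-]|[x' Xx <-]] yE; apply: sI => //; by [left|right].
exists (aut_mul (aut_inv s) v1), (aut_mul (aut_inv s) v2), (aut_mul (aut_inv s) v3).
rewrite -!aut_conjM; split=> //; exact: fixes_mul.
Qed.

Lemma chain_extend_set f1 f2 f3 k X0 A Y :
  moves_freely f1 -> moves_freely f2 -> moves_freely f3 ->
  finite_set X0 -> finite_set Y -> A `<=` X0 -> A `<=` k @` X0 ->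
  good_chain f1 f2 f3 X0 -> (forall x, X0 x -> k x = f3 (f2 (f1 x))) ->
  exists v1 v2 v3, let f1' := aut_conj f1 v1 in let f2' := aut_conj f2 v2 in
    let f3' := aut_conj f3 v3 in
    [/\ fixes v1 A, fixes v2 A, fixes v3 A, good_chain f1' f2' f3' (X0 `|` Y)
      & forall x, (X0 `|` Y) x -> k x = f3' (f2' (f1' x))].
Proof.
move=> mf1 mf2 mf3 finX0 finY AX0 Ak good kX.
elim/finite_set_ind: Y / finY => [|a Y finY].
  by exists (aut1 M), (aut1 M), (aut1 M); rewrite !aut_conj1 setU0.
move=> [u1 [u2 [u3 [u1A u2A u3A good' kY]]]].
have mf f u : moves_freely f -> moves_freely (aut_conj f u) by exact: moves_freely_conj.
have finXY : finite_set (X0 `|` Y) by fin.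
have AXY : A `<=` X0 `|` Y by move=> x /AX0; left.
have AkXY : A `<=` k @` (X0 `|` Y) by move=> x /Ak[y Xy <-]; exists y => //; left.
have [v1 [v2 [v3 [v1A v2A v3A goodv kY']]]] :=
  chain_extend a (mf f1 u1 mf1) (mf f2 u2 mf2) (mf f3 u3 mf3) finXY AXY AkXY good' kY.
exists (aut_mul u1 v1), (aut_mul u2 v2), (aut_mul u3 v3); rewrite -!aut_conjM (setUC [set a]) setUA.
by split=> //; exact: fixes_mul.
Qed.

(* Starting from [Z1 = f1 A] and [W2 = f3^-1 A], the sets [Z2], [Z3] are the
   successive images of [Z1], and [W1], [W0] the successive preimages of [W2]; each
   is made independent from the earlier ones over [A] by conjugating one factor. *)
Lemma good_chain_ex f1 f2 f3 A :
  moves_freely f1 -> moves_freely f2 -> moves_freely f3 -> finite_set A ->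
  exists v1 v2 v3 X0, let f1' := aut_conj f1 v1 in let f2' := aut_conj f2 v2 in
    let f3' := aut_conj f3 v3 in
    [/\ fixes v1 A, fixes v2 A & fixes v3 A] /\
    [/\ finite_set X0, A `<=` X0, A `<=` f3' @` (f2' @` (f1' @` X0))
      & good_chain f1' f2' f3' X0].
Proof.
move=> mf1 mf2 mf3 finA; set Z1 := f1 @` A.
have finZ1 : finite_set Z1 by fin.
have [|u uA uI] := @ind_ex A Z1 (iso_inv f3 @` A) finA finZ1; first by fin.
set g3 := aut_conj f3 (aut_inv u); pose W2 := iso_inv g3 @` A.
have finW2 : finite_set W2 by fin.
have W2Z1 w z : W2 w -> Z1 z -> ind A w z.
  move=> [a Aa <-] Zz; apply: uI => //; exists a => //=.
  by congr (iso_inv f3 _); have := fixes_inv uA Aa.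
have [v2 v2A g2I] := conj_pushed mf2 finA finW2 finZ1; set g2 := aut_conj f2 v2 in g2I.
pose Z2 := g2 @` Z1; have finZ2 : finite_set Z2 by fin.
have Z2I z b : Z2 z -> Z1 b \/ W2 b -> ind A z b by move=> [z' Zz <-]; exact: g2I.
(* Pushing the inverse of [g2] while fixing [Z1] and [Z2] frees [W1] and leaves the image of [Z1]
   equal to [Z2]. *)
have [||||v2' v2'E h2I] := @conj_pushed (aut_inv g2) (A `|` Z1 `|` Z2) W2 set0.
- exact/moves_freely_inv/moves_freely_conj.
- by fin.
- by fin.
- by fin.
set h2 := aut_conj g2 v2'; pose W1 := iso_inv h2 @` W2.
have finW1 : finite_set W1 by fin.
have h2Z1 z : Z1 z -> h2 z = g2 z.
  by move=> Zz; apply: (aut_conj_fixed v2'E); [left; right|right; exists z].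
have W1W2 w z : W1 w -> W2 z -> ind A w z.
  move=> [w' Ww <-] Wz; apply/ind_sym/(@ind_trans _ (A `|` Z1 `|` Z2)).
  - by move=> c; left; left.
  - move=> d [[Ad|Zd]|Zd]; [exact: ind_baseR|exact: W2Z1|].
    by apply/ind_sym/Z2I => //; right.
  by apply/ind_sym/h2I => //; left.
have [||||v3 v3E h3I] := @conj_pushed g3 (A `|` W2) Z2 (Z1 `|` W1).
- exact: moves_freely_conj.
- by fin.
- by fin.
- by fin.
set h3 := aut_conj g3 v3 in h3I; pose Z3 := h3 @` Z2.
have finZ3 : finite_set Z3 by fin.
have h3W2 : h3 @` W2 = A.
  rewrite -[RHS](image_autVK g3); apply: image_eq => w Ww.
  apply: (aut_conj_fixed v3E); [by right|left].
  by case: Ww => a Aa <-; rewrite iso_invK.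
have Z3I z b : Z3 z -> Z1 b \/ W1 b -> ind A z b.
  move=> [z' Zz <-] Zb; apply/ind_sym/(@ind_trans _ (A `|` W2)).
  - by move=> c; left.
  - move=> d [Ad|Wd]; first exact: ind_baseR.
    by case: Zb => ?; [exact/ind_sym/W2Z1|exact: W1W2].
  by apply/ind_sym/h3I => //; right.
have [||||v1 v1E h1I] := @conj_pushed (aut_inv f1) (A `|` Z1) W1 (Z2 `|` W2 `|` Z3).
- exact: moves_freely_inv.
- by fin.
- by fin.
- by fin.
rewrite aut_conjV in h1I; set h1 := aut_conj f1 v1 in h1I.
pose W0 := iso_inv h1 @` W1.
have h1A : h1 @` A = Z1.
  apply: image_eq => a Aa.
  by apply: (aut_conj_fixed v1E); [left|right; exists a].
have W0I w b : W0 w -> Z2 b \/ W2 b \/ Z3 b -> ind A w b.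
  move=> [w' Ww <-] Zb; apply/ind_sym/(@ind_trans _ (A `|` Z1)).
  - by move=> c; left.
  - move=> d [Ad|Zd]; first exact: ind_baseR.
    case: Zb => [?|[?|?]]; [|exact: W2Z1|]; by [apply: Z2I => //; left|apply: Z3I => //; left].
  apply/ind_sym/h1I => //; right; rewrite /=; tauto.
(* The run forward from [A] and the run backward from [A] are now followed together, starting from
   [A] and [W0]. *)
have X1E : h1 @` (A `|` W0) = Z1 `|` W1 by rewrite image_setU h1A image_autVK.
have X2E : h2 @` (Z1 `|` W1) = Z2 `|` W2.
  by rewrite image_setU image_autVK (image_eq h2Z1).
have X3E : h3 @` (Z2 `|` W2) = Z3 `|` A by rewrite image_setU h3W2.
exists v1, (aut_mul v2 v2'), (aut_mul (aut_inv u) v3), (A `|` W0).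
rewrite -!aut_conjM -/g2 -/h2 -/g3 -/h3 -/h1 /=; split.
  split; first by apply: fixes_sub v1E => c; left.
  - by apply: fixes_mul => //; apply: fixes_sub v2'E => c; left; left.
  - by apply: fixes_mul; [exact: fixes_inv|apply: fixes_sub v3E => c; left].
rewrite X1E X2E X3E; split; [by fin|exact: subsetUl|exact: subsetUr|].
rewrite /good_chain X1E X2E X3E; split=> x y.
  move=> [Zx|Ax] Zy; last by apply: ind_baseL; left.
  apply: (@ind_baseW A) => [c|d [Ad|Wd]|]; [by left|exact: ind_baseR| |exact: Z3I].
  by apply/ind_sym/W0I; tauto.
move=> [Ax|Wx] Zy; first by apply: ind_baseL; right.
apply: (@ind_baseW A) => [c|d [Zd|Ad]|]; [by right| |exact: ind_baseR|].
  by apply: W0I => //; right; right.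
by apply: W0I => //; case: Zy; [left|right; left].
Qed.

(** Once a good chain contains [A] at both ends, it extends to any finite set towards any [k']
    agreeing with [k] on its domain. So the products are dense in a basic open set around [k]. *)
Lemma dense_image f1 f2 f3 A :
  moves_freely f1 -> moves_freely f2 -> moves_freely f3 -> finite_set A ->
  exists k B, finite_set B /\
  forall k', (forall x, B x -> k' x = k x) -> forall Y, finite_set Y ->
  exists v1 v2 v3, [/\ fixes v1 A, fixes v2 A, fixes v3 A &
    forall x, Y x -> k' x = aut_conj f3 v3 (aut_conj f2 v2 (aut_conj f1 v1 x))].
Proof.
move=> mf1 mf2 mf3 finA.
have [u1 [u2 [u3 [B [[u1A u2A u3A] [finB AB AX3 good]]]]]] :=
  good_chain_ex mf1 mf2 mf3 finA.
exists (aut_mul (aut_conj f3 u3) (aut_mul (aut_conj f2 u2) (aut_conj f1 u1))), B.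
split=> // k' kk Y finY.
have mf f u : moves_freely f -> moves_freely (aut_conj f u) by exact: moves_freely_conj.
have Ak : A `<=` k' @` B by rewrite -(image_chain kk).
have [v1 [v2 [v3 [v1A v2A v3A _ kY]]]] := chain_extend_set
  (mf f1 u1 mf1) (mf f2 u2 mf2) (mf f3 u3 mf3) finB finY AB Ak good kk.
exists (aut_mul u1 v1), (aut_mul u2 v2), (aut_mul u3 v3); rewrite -!aut_conjM.
by split; try exact: fixes_mul; move=> x Yx; apply: kY; right.
Qed.
(** * Commutators with generic automorphisms *)

(** Only triangles with sides [top], [top] or [top], [alt] arise, and these are always allowed. Such
    a point separates [z] from the rest of [C]. *)
Lemma ext_top_alt C z : finite_set C -> exists y,
  [/\ ~ C y, C z -> col y z = alt K & forall c, C c -> c <> z -> col y c = top K].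
Proof.
move=> finC; pose e x := if pselect (x = z) then alt K else top K.
have ez : e z = alt K by rewrite /e; case: pselect.
have et x : x <> z -> e x = top K by rewrite /e; case: pselect.
have [|y Cy ye] := @col_ext _ _ _ _ genM C e finC.
  move=> c d _ _ cd; have [cz|cz] := pselect (c = z); have [dz|dz] := pselect (d = z).
  - by case: cd; rewrite cz dz.
  - by rewrite cz ez (et d) // ok_swap; exact: ok_top_alt.
  - by rewrite dz ez (et c) //; exact: ok_top_alt.
  - by rewrite !et //; exact: ok_top_top.
by exists y; split=> // [Cz|c Cc cz]; rewrite ye // ?ez // et.
Qed.

Lemma moved_by_label g y w : y <> w -> col y w = top K -> col y (g w) = alt K -> g y <> y.
Proof.
move=> yw yt ya gy; apply: (@top_neq_alt _ K).
by rewrite -yt -ya -{2}gy col_aut.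
Qed.

Lemma moved_outside g E w0 : g w0 <> w0 -> finite_set E ->
  exists w, [/\ ~ E w, ~ E (g w) & g w <> w].
Proof.
move=> gw0 finE; pose C := E `|` iso_inv g @` E `|` [set w0; g w0].
have [|y [Cy ya yt]] := @ext_top_alt C (g w0); first by fin.
have {}ya : col y (g w0) = alt K by apply: ya; right; right.
exists y; split=> [Ey|Egy|].
- by apply: Cy; left; left.
- by apply: Cy; left; right; exists (g y); rewrite ?iso_funK.
apply: (@moved_by_label g y w0) => //; first by move=> yw; apply: Cy; right; left.
by apply: yt; [right; left|exact/nesym].
Qed.

(** A point with label [alt] to [g w] and [top] to [w] is moved. Taking [g w] outside [C] and its
    preimage leaves the label [top] towards both sets, which gives the last two properties. *)
Lemma moved_top g C w0 : g w0 <> w0 -> finite_set C ->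
  exists p, [/\ ~ C p, ~ C (g p), g p <> p,
    forall c, C c -> col p c = top K & forall c, C c -> col (g p) c = top K].
Proof.
move=> gw0 finC; pose E := C `|` iso_inv g @` C.
have [|w [Ew Egw gw]] := @moved_outside g E w0 gw0; first by fin.
have [|y [Cy ya yt]] := @ext_top_alt (E `|` [set w; g w]) (g w); first by fin.
have {}ya : col y (g w) = alt K by apply: ya; right; right.
have yE c : E c -> col y c = top K.
  by move=> Ec; apply: yt; [left|move=> e; apply: Egw; rewrite -e].
have yE' : ~ E y by move=> Ey; apply: Cy; left.
have gE c : C c -> E (iso_inv g c) by move=> Cc; right; exists c.
exists y; split.
- by move=> Cy'; apply: yE'; left.
- by move=> /gE; rewrite iso_funK.
- apply: (@moved_by_label g y w) => //; first by move=> yw; apply: Cy; right; left.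
  by apply: yt; [right; left|exact/nesym].
- by move=> c Cc; apply: yE; left.
move=> c Cc; rewrite -(iso_invK g c) col_aut; first exact/yE/gE.
by move=> e; apply: yE'; rewrite e; exact: gE.
Qed.

(** [Phi] records what is known of the label from a point to its image: nothing for the first
    commutator, [free_label K] for the second. *)
Definition moves_with (Phi : L -> Prop) g := forall C a, finite_set C -> ~ C a ->
  exists2 u, fixes u C & g (u a) <> u a /\ Phi (col (u a) (g (u a))).

(** With [p] moved and both [p] and [g p] at label [top] from [C], any type over [C] extends by
    [top] to [p] and [alt] to [g p]. A realization cannot be fixed. *)
Lemma moves_points g w0 : g w0 <> w0 -> moves_with (fun=> True) g.
Proof.
move=> gw0 C a finC Ca; have [p [Cp Cgp gp pt gpt]] := moved_top gw0 finC.
pose e x := if pselect (C x) then col a x else if pselect (x = p) then top K else alt K.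
have eC c : C c -> e c = col a c by rewrite /e => Cc; case: pselect.
have ep : e p = top K by rewrite /e; do 2 case: pselect => //.
have egp : e (g p) = alt K by rewrite /e; do 2 case: pselect => //.
have alt_top l : ok K l (alt K) (top K).
  by rewrite ok_rot ok_swap; exact: ok_top_alt.
have top_topx l : ok K l (top K) (top K) by rewrite ok_rot; exact: ok_top_top.
have [|c d|y Fy ye] := @col_ext _ _ _ _ genM (C `|` [set p; g p]) e; first by fin.
  move=> [Cc|[]->] [Cd|[]->] cd //; rewrite ?ep ?egp ?eC //.
  - rewrite !(colC' a); apply: (col_ok genM) => // E; apply: Ca; by rewrite -E.
  - by rewrite (colC' c) pt.
  - by rewrite (colC' c) gpt.
  - by rewrite pt // ok_swap.
  - exact: ok_top_alt.
  - by rewrite gpt // ok_swap.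
  - by rewrite ok_swap; exact: ok_top_alt.
have Cy : ~ C y by move=> Cy; apply: Fy; left.
have [|u uC ua] := move1 finC Ca Cy.
  by move=> c Cc; rewrite ye ?eC //; left.
exists u => //; split=> //; rewrite ua; apply: (@moved_by_label g y p).
- by move=> yp; apply: Fy; right; left.
- by rewrite ye //; right; left.
- by rewrite ye //; right; right.
Qed.

Lemma moves_with_away Phi g C B a : moves_with Phi g -> finite_set C -> finite_set B ->
  ~ C a -> exists u, [/\ fixes u C, forall b, B b -> ind C (u a) b,
    g (u a) <> u a & Phi (col (u a) (g (u a)))].
Proof.
move=> mg finC finB Ca; have [u uC uB] := ind_ex1 a finC finB.
have Cua := fixes_out uC Ca.
have [||v vCB [gv Pv]] := mg (C `|` B) (u a); first by fin.
  by move=> [//|/uB/ind_refl].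
have vC : fixes v C by apply: fixes_sub vCB => c; left.
exists (aut_mul v u); split=> //; first exact: fixes_mul.
by move=> b Bb /=; rewrite -(vCB b); [exact/ind_fixes/uB|right].
Qed.

Definition commutator g u : Aut M := aut_mul (aut_inv g) (aut_conj g u).

(* The label between [y] and its image is freely amalgamated over a base containing
   [y] itself; [comp K l1 l2 = top K] means that [y] imposes no constraint. *)
Definition commutator_free (Phi : L -> Prop) g u C a :=
  let f := commutator g u in exists v l1 l2, let y := v a in
  [/\ fixes v C, f y <> y, free_label K (col y (f y)), Phi l1 /\ Phi l2
    & comp K l1 l2 = top K -> ind C y (f y)].

(** A generic [z] becomes the image of [y] under [u], and the preimage [w] of [g z] is chosen free
    from [g y] over [D] and [y]. The commutator sends [y] to the preimage of [w] under [g], a pair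
    with the label of [g y] and [w]. Only finitely many values of [u] matter. *)
Lemma commutator_free_open Phi g C a u0 A : moves_with Phi g ->
  finite_set C -> ~ C a -> finite_set A ->
  exists u B, [/\ finite_set B, forall x, A x -> u x = u0 x
    & forall u', (forall x, B x -> u' x = u x) -> commutator_free Phi g u' C a].
Proof.
move=> mg finC Ca finA; pose g' : M -> M := iso_inv g.
pose D := A `|` C `|` g @` C.
have finD : finite_set D by fin.
have [|v [vC yI gy Py]] := @moves_with_away Phi g C (D `|` g' @` D) a mg finC _ Ca.
  by fin.
set y := v a in yI gy Py; have Cy : ~ C y by exact: fixes_out.
have Dy : ~ D y by move=> Dy; apply: Cy; apply: ind_refl; apply: yI; left.
have Dgy : ~ D (g y).
  move=> Dgy; apply: Cy; apply: ind_refl; apply: yI; right.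
  by exists (g y); rewrite // /g' iso_funK.
pose D0 := u0 @` D; have D0y : ~ D0 (u0 y) by move=> [d Dd /aut_inj e]; apply: Dy; rewrite -e.
have [||v' [v'D zI gz Pz]] := @moves_with_away Phi g D0 (g' @` D0) (u0 y) mg _ _ D0y; try by fin.
set z := v' (u0 y) in zI gz Pz; have D0z : ~ D0 z by exact: fixes_out.
have D0gz : ~ D0 (g z).
  move=> Dgz; apply: D0z; apply: ind_refl; apply: zI.
  by exists (g z); rewrite // /g' iso_funK.
pose u1 := aut_mul v' u0.
have u1D x : D x -> u1 x = u0 x by move=> Dx; apply: v'D; exists x.
pose Dy1 := D `|` [set y]; have finDy1 : finite_set Dy1 by fin.
pose w1 := iso_inv u1 (g z); have u1w : u1 w1 = g z by exact: iso_invK.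
have Dw1 : ~ Dy1 w1.
  move=> [Dw|e]; last by apply: gz; rewrite -u1w e.
  by apply: D0gz; rewrite -u1w u1D //; exists w1.
have [s sD wI] := @ind_ex1 Dy1 [set g y] w1 finDy1 (finite_set1 _).
set w := s w1 in wI; have Dw : ~ Dy1 w by exact: fixes_out.
have {}wI : ind Dy1 w (g y) by exact: wI.
have Dy1gy : ~ Dy1 (g y) by move=> [|].
pose u2 := aut_mul u1 (aut_inv s).
have u2D x : Dy1 x -> u2 x = u1 x by move=> /(fixes_inv sD) /= e; rewrite /u2 /= e.
have u2w : u2 w = g z by rewrite /u2 /= iso_funK.
have u2y : u2 y = z by rewrite u2D //; right.
exists u2, (Dy1 `|` [set w]); split; first by fin.
  have Dx x : A x -> D x by left; left.
  by move=> x /Dx Ax; rewrite u2D ?u1D //; left.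
move=> u' u'u; pose f := commutator g u'.
have fy : f y = g' w.
  rewrite /f /= u'u ?u2y; last by left; right.
  by rewrite -u2w -u'u ?iso_funK //; right.
have ygw : y <> g' w.
  by move=> e; apply: (ind_neq Dw wI); rewrite e /g' iso_invK.
have col_yf : col y (f y) = col w (g y).
  by rewrite fy -(col_aut g ygw) /g' iso_invK colC'.
have wfree := ind_free Dw Dy1gy wI.
have wy : w <> y by move=> e; apply: Dw; rewrite e; right.
exists v, (col y (g y)), (col z (g z)); rewrite -/y -/f; split=> //.
- by rewrite fy => /esym.
- by rewrite col_yf; exact: free_col_label wfree.
move=> compt.
have colwy : col w y = col z (g z) by rewrite -(col_aut u2 wy) u2w u2y colC'.
(* The candidate that [y] contributes is the composition of the two recorded labels; as it is
   [top K], [y] leaves the base. *)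
have wD : ind D w (g y).
  constructor 3; split; first exact: ind_neq wI.
  case: wfree => o m; split=> [|c Dc]; last by apply: m; left.
  case: o => [|[c [Dc|->] e]]; [by left|by right; exists c|left].
  by rewrite e colwy (colC' (g y)) comp_sym.
rewrite fy -[C](image_autK g); apply: ind_pull; rewrite /g' iso_invK.
apply: (@ind_trans _ D) => [c ?|d Dd|]; [by right| |exact: ind_sym].
by rewrite -(iso_invK g d); apply/ind_aut/yI; right; exists d.
Qed.

(** * Limits of automorphisms and generic automorphisms *)

Lemma dependent_seq (T : Type) (P : T -> Prop) (R : nat -> T -> T -> Prop) t0 :
  P t0 -> (forall n t, P t -> exists2 t', P t' & R n t t') ->
  exists s : nat -> T, forall n, P (s n) /\ R n (s n) (s n.+1).
Proof.
move=> P0 step.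
have /choice[F FP] (nt : nat * T) : exists t', P nt.2 -> P t' /\ R nt.1 nt.2 t'.
  have [/(step nt.1)[t' ? ?]|nP] := pselect (P nt.2); first by exists t'.
  by exists t0.
pose fix s n := if n is m.+1 then F (m, s m) else t0.
have sP n : P (s n) by elim: n => //= n IH; exact: (FP (n, s n) IH).1.
by exists s => n; split=> //; exact: (FP (n, s n) (sP n)).2.
Qed.

(** The last hypothesis keeps every preimage stable from some stage on, which makes the limit
    surjective. *)
Lemma aut_limit (u : nat -> Aut M) (A : nat -> set M) :
  (forall n, A n `<=` A n.+1) -> (forall n x, A n x -> u n.+1 x = u n x) ->
  (forall x, exists n, A n x) -> (forall x, exists n, A n (iso_inv (u n) x)) ->
  exists v : Aut M, forall n x, A n x -> v x = u n x.
Proof.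
move=> Amono uA /choice[i iP] /choice[j jP].
have mono m n x : m <= n -> A m x -> A n x /\ u n x = u m x.
  move=> /subnK <-; elim: (n - m) => //= d IH Ax.
  by have [Adx <-] := IH Ax; split; [exact: Amono|exact: uA].
pose v x := u (i x) x; pose w x := iso_inv (u (j x)) x.
have vE n x : A n x -> v x = u n x.
  move=> Ax; rewrite /v; have [_ <-] := mono _ _ x (leq_maxl n (i x)) Ax.
  by have [_ <-] := mono _ _ x (leq_maxr n (i x)) (iP x).
have v2 x y : exists n, v x = u n x /\ v y = u n y.
  exists (maxn (i x) (i y)).
  have [Ax _] := mono _ _ x (leq_maxl (i x) (i y)) (iP x).
  by have [Ay _] := mono _ _ y (leq_maxr (i x) (i y)) (iP y); split; apply: vE.
have vw : cancel w v by move=> x; rewrite (vE (j x)) /w ?iso_invK.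
have wv : cancel v w.
  by move=> x; have [n [e1 e2]] := v2 (w (v x)) x; have := vw (v x); rewrite e1 {2}e2 => /aut_inj.
have vR l x y : rel_of l (v x) (v y) <-> rel_of l x y.
  by have [n [-> ->]] := v2 x y; exact: iso_rel.
by exists (Isomorphism wv vw vR) => n x /vE.
Qed.

Variable pt : nat -> M.
Hypothesis pt_surj : forall x, exists n, pt n = x.

(** A Baire category argument: stage [n] secures condition [n] and freezes the automorphism at
    [pt n] and at its preimage. *)
Lemma generic_aut (Theta : nat -> Aut M -> Prop) :
  (forall n u A, finite_set A -> exists u' B, [/\ finite_set B,
     forall x, A x -> u' x = u x
     & forall u'', (forall x, B x -> u'' x = u' x) -> Theta n u'']) ->
  exists u, forall n, Theta n u.
Proof.
move=> open_dense.
pose P (t : Aut M * set M) := finite_set t.2.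
pose R n (t t' : Aut M * set M) := [/\ t.2 `<=` t'.2, forall x, t.2 x -> t'.1 x = t.1 x,
  t'.2 (pt n), t'.2 (iso_inv t'.1 (pt n))
  & forall u, (forall x, t'.2 x -> u x = t'.1 x) -> Theta n u].
have [||s sP] := @dependent_seq _ P R (aut1 M, set0).
- exact: finite_set0.
- move=> n [u A] /= finA; have [u' [B [finB u'A uB]]] := open_dense n u A finA.
  exists (u', A `|` B `|` [set pt n; iso_inv u' (pt n)]); first by rewrite /P /=; fin.
  split=> /=; [by move=> x; left; left|exact: u'A|by right; left|by right; right|].
  by move=> u'' e; apply: uB => x Bx; apply: e; left; right.
have [||x|x|v vP] := @aut_limit (fun n => (s n.+1).1) (fun n => (s n.+1).2).
- by move=> n; have [_ []] := sP n.+1.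
- by move=> n x; have [_ [_ + _ _ _]] := sP n.+1; apply.
- by have [n <-] := pt_surj x; exists n; have [_ []] := sP n.
- by have [n <-] := pt_surj x; exists n; have [_ []] := sP n.
by exists v => n; have [_ [_ _ _ _]] := sP n; apply; exact: vP.
Qed.

Lemma finite_set_pt C : finite_set C -> exists l : seq nat, C = pt @` [set` l].
Proof.
elim/finite_set_ind => [|x A finA [l ->]]; first by exists [::]; rewrite set_nil image_set0.
have [n <-] := pt_surj x; exists (n :: l); apply/seteqP; split=> y.
  case=> [->|[m ml <-]]; [exists n|exists m] => //=; rewrite inE ?eqxx //.
  by apply/orP; right.
case=> m /=; rewrite inE => /orP[/eqP->|ml] <-; [by left|by right; exists m].
Qed.

Lemma commutator_generic Phi g : moves_with Phi g ->
  exists u, forall C a, finite_set C -> ~ C a -> commutator_free Phi g u C a.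
Proof.
(* Countably many pairs of a finite set and a point are coded by numbers; a number coding none is
   read as the empty set with [pt 0]. *)
move=> mg; pose code n := odflt ([::], 0) (unpickle n : option (seq nat * nat)).
pose Theta n u := ~ (pt @` [set` (code n).1]) (pt (code n).2) ->
  commutator_free Phi g u (pt @` [set` (code n).1]) (pt (code n).2).
have [|u uP] := @generic_aut Theta.
  move=> n u A finA; rewrite /Theta; set C := pt @` _.
  have finC : finite_set C by fin; exact: finite_seq.
  have [Ca|Ca] := pselect (C (pt (code n).2)).
    by exists u, set0; split.
  have [u' [B [finB u'A BP]]] := commutator_free_open u mg finC Ca finA.
  by exists u', B; split=> // u'' /BP.
exists u => C a /finite_set_pt[l ->]; have [m <-] := pt_surj a.
by have := uP (pickle (l, m)); rewrite /Theta /code pickleK.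
Qed.

(** The first commutator has free labels to its images. For the second, both recorded labels are
    therefore free, so [comp_free] gives the proviso of [commutator_free]. *)
Lemma commutators_move_freely g w0 : g w0 <> w0 ->
  exists u u', moves_freely (commutator (commutator g u) u').
Proof.
move=> /moves_points/commutator_generic[u uP]; set f := commutator g u in uP.
have [|u' u'P] := @commutator_generic (free_label K) f.
  by move=> C a finC Ca; have [v [_ [_ [vC fv fl _ _]]]] := uP C a finC Ca; exists v.
exists u, u' => C a finC; have [Ca|Ca] := pselect (C a).
  by exists (aut1 M) => //; exact: ind_baseL.
have [v [l1 [l2 [vC _ _ [f1 f2] h]]]] := u'P C a finC Ca.
by exists v => //; apply: h; exact: comp_free.
Qed.

(** * Every automorphism is a quotient of two products of conjugates *)

Section ConjugateProducts.
Variable g : Aut M.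
Hypothesis mg : moves_freely g.

Definition triple : Type := Aut M * Aut M * Aut M.
Implicit Types (s t : triple).

Definition conj_prod t : Aut M :=
  aut_mul (aut_conj g t.2) (aut_mul (aut_conj g t.1.2) (aut_conj g t.1.1)).

Definition agree (A : set M) t s :=
  forall x, A x -> [/\ s.1.1 x = t.1.1 x, s.1.2 x = t.1.2 x & s.2 x = t.2 x].

(** The value [z] of the conjugate at [x] is characterized by [u z = g (u x)]. *)
Lemma aut_conj_agree u v x : v x = u x ->
  v (aut_conj g u x) = u (aut_conj g u x) -> aut_conj g v x = aut_conj g u x.
Proof.
move=> e1 e2; apply: (@aut_inj v); rewrite e2 /= !iso_invK.
by rewrite e1.
Qed.

Lemma conj_prod_cont t F : finite_set F -> exists2 A, finite_set A &
  forall s, agree A t s -> forall x, F x -> conj_prod s x = conj_prod t x.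
Proof.
move=> finF; case: t => [[t1 t2] t3].
pose F1 := aut_conj g t1 @` F; pose F2 := aut_conj g t2 @` F1.
pose F3 := aut_conj g t3 @` F2.
exists (F `|` F1 `|` F2 `|` F3); first by fin.
move=> [[s1 s2] s3] st x Fx.
have Fx1 : F1 (aut_conj g t1 x) by exists x.
have Fx2 : F2 (aut_conj g t2 (aut_conj g t1 x)) by exists (aut_conj g t1 x).
have Fx3 : F3 (aut_conj g t3 (aut_conj g t2 (aut_conj g t1 x))) by eexists; first exact: Fx2.
have [e0 _ _] := st x (or_introl (or_introl (or_introl Fx))).
have [e1 e1' _] := st _ (or_introl (or_introl (or_intror Fx1))).
have [_ e2 e2'] := st _ (or_introl (or_intror Fx2)).
have [_ _ e3] := st _ (or_intror Fx3).
rewrite -[LHS]/(aut_conj g s3 (aut_conj g s2 (aut_conj g s1 x))).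
by rewrite (aut_conj_agree e0 e1) (aut_conj_agree e1' e2) (aut_conj_agree e2' e3).
Qed.

(** Products of triples near [t] over [A] are dense in the neighbourhood of [k] given by [B], for
    pointwise convergence. *)
Definition dense_at t A k B := [/\ finite_set A, finite_set B &
  forall k', (forall x, B x -> k' x = k x) -> forall Y, finite_set Y ->
  exists2 s, agree A t s & forall x, Y x -> conj_prod s x = k' x].

Lemma dense_at_ex t A : finite_set A -> exists k B, dense_at t A k B.
Proof.
move=> finA.
have mc u : moves_freely (aut_conj g u) by exact: moves_freely_conj.
have [k [B [finB kB]]] := dense_image (mc t.1.1) (mc t.1.2) (mc t.2) finA.
exists k, B; split=> // k' kk' Y finY.
have [v1 [v2 [v3 [v1A v2A v3A kY]]]] := kB k' kk' Y finY.
exists (aut_mul t.1.1 v1, aut_mul t.1.2 v2, aut_mul t.2 v3).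
  by move=> x Ax /=; rewrite v1A ?v2A ?v3A.
by move=> x Yx; rewrite kY // !aut_conjM.
Qed.

(** The empty chain is good, so unrestricted conjugators give products dense in the whole group: the
    start of the back and forth. *)
Lemma dense_at0 t k : dense_at t set0 k set0.
Proof.
split=> // k' _ Y finY.
have mc u : moves_freely (aut_conj g u) by exact: moves_freely_conj.
have [//|//|||v1 [v2 [v3 [_ _ _ _ kY]]]] := @chain_extend_set _ _ _ k' set0 set0 Y
  (mc t.1.1) (mc t.1.2) (mc t.2) (finite_set0 M) finY.
- by rewrite /good_chain !image_set0.
- by [].
exists (aut_mul t.1.1 v1, aut_mul t.1.2 v2, aut_mul t.2 v3) => // x Yx.
by rewrite kY ?set0U // !aut_conjM.
Qed.

(* Back-and-forth position between the factorizations of [a] (close to [t]) and of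
   [b = a h] (close to [s]); [half_step] exchanges their roles, replacing [h] by its
   inverse. *)
Definition half_state h t A k B s :=
  dense_at t A k B /\ forall y, B (h y) -> conj_prod s y = k (h y).

(** Continuity freezes the product of [s] on [F] and the preimage of [B]. A dense neighbourhood of
    some [l] near that product is taken, and [t] is then corrected to match [l] composed with the
    inverse of [h]. *)
Lemma half_step h t A k B s F E : half_state h t A k B s ->
  finite_set F -> finite_set E ->
  exists A' l B' t', [/\ half_state (aut_inv h) s A' l B' t', E `<=` A', agree A t t',
    forall x, F x -> conj_prod t' (h x) = conj_prod s x
    & forall s', agree A' s s' -> forall x, F x -> conj_prod s' x = conj_prod s x].
Proof.
move=> [[finA finB dense] sB] finF finE; pose h' : M -> M := iso_inv h.
pose Y := F `|` h' @` B; have finY : finite_set Y by fin.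
have [A0 finA0 cont] := conj_prod_cont s finY.
have [|l [B' dl]] := @dense_at_ex s (A0 `|` E); first by fin.
have [finA' finB' dense'] := dl.
(* [l] is approximated by products of triples that agree with [s] where continuity requires it. *)
have lY x : Y x -> l x = conj_prod s x.
  move=> Yx; have [s' ss' s'Y] := dense' l (fun _ _ => erefl) Y finY.
  by rewrite -s'Y //; apply: cont => // z Az; apply: ss'; left.
have hY b : B b -> Y (h' b) by move=> Bb; right; exists b.
have [||t' tt' t'Y] := dense (aut_mul l (aut_inv h)) _ (h @` (B' `|` F)).
- move=> b Bb /=; rewrite -/(h' b) lY; last exact: hY.
  by rewrite sB /h' ?iso_invK.
- by fin.
exists (A0 `|` E), l, B', t'; split.
- split=> // y By; rewrite t'Y //=; exists (iso_inv h y); last exact: iso_invK.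
  by left.
- exact: subsetUr.
- exact: tt'.
- move=> x Fx; rewrite t'Y /= ?iso_funK; first by rewrite lY //; left.
  by exists x; [right|].
- by move=> s' ss' x Fx; apply: cont => [z Az|]; [apply: ss'; left|left].
Qed.

(** The points to freeze so that all three conjugators have automorphisms as limits. *)
Definition around t x : set M :=
  [set x; iso_inv t.1.1 x] `|` [set iso_inv t.1.2 x; iso_inv t.2 x].

Lemma around_fin t x : finite_set (around t x).
Proof. by rewrite /around; fin. Qed.

Lemma triple_limit (t : nat -> triple) (A : nat -> set M) :
  (forall n, A n `<=` A n.+1) -> (forall n, agree (A n) (t n) (t n.+1)) ->
  (forall n, around (t n) (pt n) `<=` A n) ->
  exists t', forall n, agree (A n) (t n) t'.
Proof.
move=> mono tA arA.
have lim p : (forall n x, A n x -> (p (t n.+1) : Aut M) x = p (t n) x) ->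
    (forall n, A n (iso_inv (p (t n)) (pt n))) ->
    exists v : Aut M, forall n x, A n x -> v x = p (t n) x.
  move=> pA pinv; apply: aut_limit => // x; have [n <-] := pt_surj x; exists n => //.
  by apply: arA; left; left.
have [||v1 v1P] := lim (fun s => s.1.1).
- by move=> n x /tA[].
- by move=> n; apply: arA; left; right.
have [||v2 v2P] := lim (fun s => s.1.2).
- by move=> n x /tA[].
- by move=> n; apply: arA; right; left.
have [||v3 v3P] := lim (fun s => s.2).
- by move=> n x /tA[].
- by move=> n; apply: arA; right; right.
by exists (v1, v2, v3) => n x Ax /=; rewrite (v1P n) ?(v2P n) ?(v3P n).
Qed.

Record state := State {
  st_t : triple; st_A : set M; st_k : Aut M; st_B : set M; st_s : triple; st_E : set M }.

Lemma conj_prod_ratio h : exists t s, aut_mul (conj_prod t) h = conj_prod s.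
Proof.
pose P S := half_state h (st_t S) (st_A S) (st_k S) (st_B S) (st_s S) /\ finite_set (st_E S).
(* [st_A] and [st_E] are where [t] and [s] are frozen. A step freezes [s] before changing it and [t]
   afterwards, so [st_E S'] goes with [st_s S] but [st_A S'] with [st_t S']. *)
pose R n S S' := [/\
  st_A S `<=` st_A S' /\ st_E S `<=` st_E S',
  agree (st_A S) (st_t S) (st_t S') /\ agree (st_E S') (st_s S) (st_s S'),
  around (st_t S') (pt n) `<=` st_A S', around (st_s S) (pt n) `<=` st_E S'
  & exists y, [/\ y = conj_prod (st_s S) (pt n),
     forall t, agree (st_A S') (st_t S') t -> conj_prod t (h (pt n)) = y &
     forall s, agree (st_E S') (st_s S) s -> conj_prod s (pt n) = y]].
pose t0 : triple := (aut1 M, aut1 M, aut1 M).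
have [||S SP] := @dependent_seq _ P R (State t0 set0 (aut1 M) set0 t0 set0).
- by split=> //; split=> //; exact: dense_at0.
- move=> n [t A k B s E] [/= hs finE].
  have finA : finite_set A by have [[]] := hs.
  have [||A' [l [B' [t' [hs' EA' tt' ht' cont]]]]] :=
    @half_step h t A k B s [set pt n] (E `|` around s (pt n)) hs; [by fin|..].
    by rewrite finite_setU; split=> //; exact: around_fin.
  have finA' : finite_set A' by have [[]] := hs'.
  have [||A2 [k2 [B2 [s' [hs2 EA2 ss' _ cont2]]]]] :=
    @half_step (aut_inv h) s A' l B' t' [set h (pt n)] (A `|` around t' (pt n)) hs'; [by fin|..].
    by rewrite finite_setU; split=> //; exact: around_fin.
  exists (State t' A2 k2 B2 s' A'); first by split=> //; move: hs2; congr half_state; exact: aut_eq.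
  split.
  + by split=> x ?; [apply: EA2|apply: EA']; left.
  + by split.
  + by move=> x ?; apply: EA2; right.
  + by move=> x ?; apply: EA'; right.
  exists (conj_prod s (pt n)); split=> // [t2 tt2|s2 ss2].
    by rewrite (cont2 _ tt2) // ht'.
  exact: cont.
have [|||t tP] := @triple_limit (fun n => st_t (S n.+1)) (fun n => st_A (S n.+1)).
- by move=> n; have [_ [[]]] := SP n.+1.
- by move=> n; have [_ [_ []]] := SP n.+1.
- by move=> n; have [_ []] := SP n.
have [|||s sP] := @triple_limit (fun n => st_s (S n)) (fun n => st_E (S n.+1)).
- by move=> n; have [_ [[]]] := SP n.+1.
- by move=> n; have [_ [_ []]] := SP n.
- by move=> n; have [_ []] := SP n.
exists t, s; apply: aut_eq => x; have [n <-] := pt_surj x.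
have [_ [_ _ _ _ [y [_ ty sy]]]] := SP n.
by rewrite -[LHS]/(conj_prod t (h (pt n))) ty ?sy; [|exact: sP|exact: tP].
Qed.
End ConjugateProducts.
End Independence.

(** * Simplicity for generic structures *)

Lemma generic_simple (L : Type) (K : amalgam_rule L) (M : lstructure L)
    (col : M -> M -> L) :
  generic_structure K col -> countable [set: M] -> simple_group (Aut M).
Proof.
move=> genM cM.
(* Extension over the empty set shows that [M] is nonempty; [y0] serves as default value of the
   enumeration. *)
have [//|y0 _ _] := @col_ext _ _ _ _ genM set0 (fun=> top K) (finite_set0 M).
have [pt pt_surj] : exists pt : nat -> M, forall x, exists n, pt n = x.
  have /countable_injP[f finj] := cM.
  have /choice[pt ptP] n : exists x, (exists x', f x' = n) -> f x = n.
    have [[x fx]|nx] := pselect (exists x', f x' = n); first by exists x.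
    by exists y0.
  exists pt => x; exists (f x); apply: finj; rewrite ?inE //.
  by apply: ptP; exists x.
split.
  have [//|y1 y01 _] := @col_ext _ _ _ _ genM [set y0] (fun=> top K) (finite_set1 y0).
    by move=> c d -> ->.
  have [//|//|//|u _ uy] := @move1 _ _ _ _ genM set0 y0 y1 (finite_set0 M).
  by exists u => u1; apply: y01; rewrite -uy u1.
move=> N [N1 NM NV NJ]; have [[g [Ng g1]]|triv] := pselect (exists g, N g /\ g <> 1%g).
  right; apply/seteqP; split=> // h _.
  have [w gw] : exists w, g w <> w.
    apply: contrapT => /forallNP fixg; apply: g1; apply: aut_eq => x.
    by apply: contrapT => n; exact: (fixg x).
  have [u [u' mf]] := commutators_move_freely genM pt_surj gw.
  set f := commutator _ _ in mf.
  have Ncomm k v : N k -> N (commutator k v).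
    by move=> Nk; apply: (NM (aut_inv k) (aut_conj k v)); [exact: NV|exact: NJ].
  have Nf : N f by exact: (Ncomm _ _ (Ncomm _ _ Ng)).
  have Nprod t : N (conj_prod f t).
    apply: (NM (aut_conj f _) (aut_mul _ _)); first exact: NJ.
    by apply: (NM (aut_conj f _) (aut_conj f _)); exact: NJ.
  have [t [s e]] := conj_prod_ratio genM pt_surj mf h.
  have -> : h = aut_mul (aut_inv (conj_prod f t)) (conj_prod f s).
    by rewrite -e; apply: aut_eq => x; rewrite [RHS]iso_funK.
  by apply: (NM (aut_inv _)); [exact: NV|].
left; apply/seteqP; split=> [g Ng|_ -> //].
by apply: contrapT => g1; apply: triv; exists g.
Qed.

(** * Fraisse limits of classes omitting triangles *)

Definition same_triangle (L : Type) (t : triangle L) (a b c : L) : Prop :=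
  let: (p, q, r) := t in
  [\/ (p, q, r) = (a, b, c), (p, q, r) = (b, c, a), (p, q, r) = (c, a, b) |
   [\/ (p, q, r) = (b, a, c), (p, q, r) = (a, c, b) | (p, q, r) = (c, b, a)]].

Section FraisseLimit.
Variables (L : Type) (K : amalgam_rule L) (S : seq (triangle L)).
Hypothesis okS : forall a b c,
  ok K a b c <-> forall t, List.In t S -> ~ same_triangle t a b c.

Lemma coloured_Forb_c (A : lstructure L) (col : A -> A -> L) :
  finite_set [set: A] -> (forall x y, col x y = col y x) ->
  (forall l x y, rel_of l x y <-> x <> y /\ col x y = l) ->
  (forall x y z, x <> y -> y <> z -> x <> z -> ok K (col x z) (col y z) (col x y)) ->
  Forb_c S A.
Proof.
move=> finA colC relC cok; split=> // [x y xy|[[a b] c] tS [f [finj fR]]].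
  by exists (col x y); split; [apply/relC|move=> l /relC[]].
pose i0 : 'I_3 := @Ordinal 3 0 isT; pose i1 : 'I_3 := @Ordinal 3 1 isT.
pose i2 : 'I_3 := @Ordinal 3 2 isT.
have [n01 e01] : f i0 <> f i1 /\ col (f i0) (f i1) = a by apply/relC/fR.
have [n12 e12] : f i1 <> f i2 /\ col (f i1) (f i2) = b by apply/relC/fR.
have [n02 e02] : f i0 <> f i2 /\ col (f i0) (f i2) = c by apply/relC/fR.
have := cok (f i0) (f i2) (f i1) n02 (nesym n12) n01.
rewrite (colC (f i2)) e01 e12 e02 => /okS /(_ _ tS); apply.
by constructor 1.
Qed.

Variable M : lstructure L.
Hypothesis limM : is_fraisse_limit (Forb_c S) M.

Definition sub_elt (D : set M) (x : M) (Dx : D x) : substructure D := SigSub (mem_set Dx).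

Lemma substructure_Forb_c (D : set M) : finite_set D -> Forb_c S (substructure D).
Proof.
by move=> finD; case: limM => _ _ ageM; apply/ageM; exists D => //; constructor; exact: aut1.
Qed.

Lemma limit_complete : complete M.
Proof.
move=> x y xy.
have fin : finite_set [set x; y] by rewrite finite_setU; split; exact: finite_set1.
have Dx : [set x; y] x by left.
have Dy : [set x; y] y by right.
have [_ cD _] := substructure_Forb_c fin.
by have [|l] := cD (sub_elt Dx) (sub_elt Dy); [move=> /(congr1 val)|exists l].
Qed.

(** Three points span a finite substructure, which lies in the class, and [v] would embed the
    forbidden triangle in it. *)
Lemma triangle_free (v0 v1 v2 : M) a b c : v0 <> v1 -> v1 <> v2 -> v0 <> v2 ->
  rel_of a v0 v1 -> rel_of b v1 v2 -> rel_of c v0 v2 -> ~ List.In (a, b, c) S.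
Proof.
move=> n01 n12 n02 r01 r12 r02 tS.
(* The default of [nth] supplies the third vertex. *)
pose v (i : 'I_3) := nth v2 [:: v0; v1] i; pose D := range v.
have finD : finite_set D by apply: finite_image; exact: finite_finset.
have [_ _ /(_ _ tS)] := substructure_Forb_c finD; apply.
have Dv i : D (v i) by exists i.
have vR l i j : rel_of l (v i) (v j) <-> triangle_edge (a, b, c) i j = Some l.
  have un l' (x y : M) : x <> y -> rel_of l' x y -> rel_of l x y <-> Some l' = Some l.
    move=> xy r'; split=> [r|[<-] //].
    by have [l0 [_ u]] := limit_complete xy; rewrite -(u _ r) -(u _ r').
  have sR l' (x y : M) : rel_of l' x y -> rel_of l' y x by exact: rel_of_sym.
  have irr (x : M) : rel_of l x x <-> None = Some l.
    by split=> // r; case: (@rel_of_irr _ _ _ _ r).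
  case: i => [[|[|[|//]]] ?]; case: j => [[|[|[|//]]] ?]; rewrite /v /=;
    first [exact: irr | by apply: un; first [assumption|exact/nesym|exact: sR]].
exists (fun i => sub_elt (Dv i)); split=> // i j /(congr1 val) /= e.
have ev : v i = v j := e.
case: i j {e} ev => [[|[|[|//]]] p] [[|[|[|//]]] q]; rewrite /v /= => ev;
  by [apply: val_inj|case: n01|case: n12|case: n02].
Qed.

Lemma limit_col : exists col : M -> M -> L, [/\ forall x y, col x y = col y x,
  forall l x y, rel_of l x y <-> x <> y /\ col x y = l
  & forall x y z, x <> y -> y <> z -> x <> z -> ok K (col x z) (col y z) (col x y)].
Proof.
have /choice[c cP] (p : M * M) : exists l, p.1 <> p.2 -> rel_of l p.1 p.2.
  have [e|/limit_complete[l [r _]]] := pselect (p.1 = p.2); last by exists l.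
  (* An arbitrary label on the diagonal. *)
  by exists (top K).
have un l l' (x y : M) : x <> y -> rel_of l x y -> rel_of l' x y -> l = l'.
  by move=> /limit_complete[l0 [_ u]] /u <- /u <-.
pose col x y := c (x, y).
have colR x y : x <> y -> rel_of (col x y) x y by exact: (cP (x, y)).
have colC x y : col x y = col y x.
  have [->//|xy] := pselect (x = y); apply: un (colR _ _ xy) _ => //.
  exact/rel_of_sym/colR/nesym.
exists col; split=> // [l x y|x y z xy yz xz].
  split=> [r|[xy <-]]; last exact: colR.
  have xy : x <> y by move=> e; rewrite e in r; case: (@rel_of_irr _ _ _ _ r).
  by split=> //; exact: un (colR _ _ xy) r.
apply/okS => -[[p q] r] tS st.
have yx := nesym xy; have zy := nesym yz; have zx := nesym xz.
have tf v0 v1 v2 : v0 <> v1 -> v1 <> v2 -> v0 <> v2 ->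
    (p, q, r) <> (col v0 v1, col v1 v2, col v0 v2).
  move=> n01 n12 n02 e; move: tS; rewrite e.
  by apply: (@triangle_free v0 v1 v2) => //; exact: colR.
case: st => [e|e|e|[e|e|e]].
- by apply: (tf x z y); rewrite // (colC z).
- by apply: (tf z y x); rewrite // (colC z) (colC y x) (colC z).
- by apply: (tf y x z); rewrite // (colC y x).
- by apply: (tf y z x); rewrite // (colC z) (colC y x).
- by apply: (tf z x y); rewrite // (colC z x) (colC z).
- by apply: (tf x y z).
Qed.

Lemma substructure_extend (col : M -> M -> L) (C : set M) (p : M -> M) :
  (forall l x y, rel_of l x y <-> x <> y /\ col x y = l) -> finite_set C ->
  (forall c d, C c -> C d -> c <> d -> p c <> p d /\ col (p c) (p d) = col c d) ->
  exists u : Aut M, forall c, C c -> u c = p c.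
Proof.
move=> relC finC pC; case: limM => _ homM _.
have pE (x : substructure C) : (p @` C) (p (val x)) by exists (val x) => //; exact: set_valP.
have /choice[q qP] (y : substructure (p @` C)) : exists x : substructure C, p (val x) = val y.
  by have [c Cc e] := set_valP y; exists (sub_elt Cc).
pose f (x : substructure C) := sub_elt (pE x).
have pinj c d : C c -> C d -> p c = p d -> c = d.
  by move=> Cc Cd e; apply: contrapT => /(pC c d Cc Cd)[].
have qf : cancel q f by move=> y; apply: val_inj; exact: qP.
have fq : cancel f q.
  by move=> x; apply/val_inj/pinj; [exact: set_valP|exact: set_valP|exact: qP].
have fR l x y : rel_of l (f x) (f y) <-> rel_of l x y.
  have Cx : C (val x) := set_valP x; have Cy : C (val y) := set_valP y.
  rewrite /= !relC; split=> [[n <-]|[n <-]].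
    have n' : val x <> val y by move=> e; apply: n; rewrite e.
    by have [_ ->] := pC _ _ Cx Cy n'.
  exact: pC.
have [g gP] := homM _ _ finC (finite_image p finC) (Isomorphism fq qf fR).
by exists g => c Cc; rewrite (gP (sub_elt Cc)).
Qed.

(** For [col_ext], the one-point extension of [C] is built on an option type and belongs to the
    class, so it embeds in [M]. Homogeneity then carries its copy of [C] back onto [C]. *)
Lemma limit_generic : exists col : M -> M -> L, generic_structure K col.
Proof.
have [col [colC relC cok]] := limit_col; exists col.
have homC := substructure_extend relC.
split=> // C e finC eok.
pose A0 := option (substructure C).
pose colA (x y : A0) : L := match x, y with
  | Some c, Some d => col (val c) (val d)
  | Some c, None | None, Some c => e (val c)
  | None, None => top K end.
have colAC x y : colA x y = colA y x by case: x y => [x|] [y|] //=.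
pose A := @LStructure L A0 (fun l x y => x <> y /\ colA x y = l)
  (fun l x y h => conj (nesym h.1) (etrans (colAC y x) h.2)) (fun l x h => h.1 erefl).
have Cv (c : substructure C) : C (val c) := set_valP c.
have neqv (c d : substructure C) : Some c <> Some d -> val c <> val d.
  by move=> n /val_inj h; apply: n; rewrite h.
have AK : Forb_c S A.
  apply: (@coloured_Forb_c A colA) => //.
    apply: (@sub_finite_set _ _ (None |` Some @` [set: substructure C])).
      by case=> [x|] _; [right; exists x|left].
    rewrite finite_setU; split; first exact: finite_set1.
    by apply: finite_image; have [] := substructure_Forb_c finC.
  move=> [x|] [y|] [z|] //= xy yz xz.
  - by apply: cok; exact: neqv.
  - by apply: eok; [exact: Cv|exact: Cv|exact: neqv].
  - by rewrite ok_rot ok_swap; apply: eok; [exact: Cv|exact: Cv|exact: neqv].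
  - by rewrite ok_rot ok_rot; apply: eok; [exact: Cv|exact: Cv|exact: neqv].
case: limM => _ _ /(_ A)[/(_ AK)[D finD [phi]] _].
have phiR x y : x <> y -> val (phi x) <> val (phi y) /\ col (val (phi x)) (val (phi y)) = colA x y.
  by move=> xy; apply/relC; have [_] := iso_rel phi (colA x y) x y; apply.
pose p x := if pselect (C x) is left Cx then val (phi (Some (sub_elt Cx))) else x.
have pE c (Cc : C c) : p c = val (phi (Some (sub_elt Cc))).
  rewrite /p; case: pselect => // Cc'; congr (val (phi (Some _))).
  exact: val_inj.
have [|u uP] := homC C p finC.
  move=> c d Cc Cd cd; rewrite (pE c Cc) (pE d Cd).
  by apply: (phiR (Some (sub_elt Cc)) (Some (sub_elt Cd))) => -[].
pose y := iso_inv u (val (phi None)).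
have uy : u y = val (phi None) by exact: iso_invK.
have neq c (Cc : C c) : val (phi (Some (sub_elt Cc))) <> val (phi None).
  by apply: (proj1 (phiR (Some _) None _)).
have yC : ~ C y by move=> Cy; apply: (neq y Cy); rewrite -uy -(pE y Cy) uP.
exists y => // c Cc.
have yc : y <> c by move=> eyc; apply: yC; rewrite eyc.
have : rel_of (e c) (u y) (u c).
  rewrite uy uP // (pE c Cc); apply/relC.
  by apply: (phiR None (Some _)).
by move/(iso_rel u)/relC => -[].
Qed.
End FraisseLimit.

(** * Priority rules *)

Section PriorityRule.
Variables (L : Type) (els : seq L) (code : L -> nat).
Hypothesis els_complete : forall f : pred L, all f els -> forall x, f x.
Hypothesis code_inj : injective code.
Variables (S : seq (triangle L)) (P Q T : L).

Definition lbl_eq (x y : L) := code x == code y.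

Lemma lbl_eqP x y : reflect (x = y) (lbl_eq x y).
Proof. by apply: (iffP eqP) => [/code_inj|->]. Qed.

Definition tri_eq (t : triangle L) (a b c : L) :=
  let: (p, q, r) := t in
  let eq3 x y z := [&& lbl_eq p x, lbl_eq q y & lbl_eq r z] in
  [|| eq3 a b c, eq3 b c a, eq3 c a b, eq3 b a c, eq3 a c b | eq3 c b a].

Definition tri_ok a b c := all (fun t => ~~ tri_eq t a b c) S.

Lemma tri_eqP t a b c : reflect (same_triangle t a b c) (tri_eq t a b c).
Proof.
case: t => [[p q] r].
have eq3P x y z : reflect ((p, q, r) = (x, y, z)) [&& lbl_eq p x, lbl_eq q y & lbl_eq r z].
  by apply: (iffP and3P) => [[/lbl_eqP-> /lbl_eqP-> /lbl_eqP->]|[-> -> ->]] //; split; exact/lbl_eqP.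
apply: (iffP or4P) => /=.
  case=> [/eq3P|/eq3P|/eq3P|/or3P[/eq3P|/eq3P|/eq3P]] e;
    by [constructor 1|constructor 2|constructor 3|constructor 4; constructor 1
       |constructor 4; constructor 2|constructor 4; constructor 3].
case=> [e|e|e|[e|e|e]]; [constructor 1|constructor 2|constructor 3|constructor 4..];
  rewrite ?(introT (eq3P _ _ _) e) ?orbT //.
Qed.

Lemma tri_okP a b c : tri_ok a b c <-> forall t, List.In t S -> ~ same_triangle t a b c.
Proof.
rewrite /tri_ok; elim: S => [|t s IHs] /=; first by split.
split=> [/andP[/tri_eqP nt /IHs h] u [<-|/h] //|h].
apply/andP; split; first by apply/tri_eqP/h; left.
by apply/IHs => u us; apply: h; right.
Qed.

Definition prio a b := if tri_ok a b P then P else if tri_ok a b Q then Q else T.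

(** Preferred labels rank higher because the least rank wins: one base point excluding [P] suffices
    to reject it. *)
Definition prio_rank x := if lbl_eq x P then 2 else if lbl_eq x Q then 1 else 0.

Definition all_free (f : pred L) :=
  f P && all (fun x => all (fun y => f (prio x y)) els) els.

(* A conditional rather than [==>], so that [vm_compute] prunes the search. *)
Local Notation "a =>> b" := (if a then b else true) (at level 99, right associativity).
Local Notation "'ALL' x , b" := (all (fun x => b) els) (at level 200, x name).

(** The axioms of [amalgam_rule] as finite searches. The costly ones are in contrapositive form,
    with the rare failing triangle tested first. *)
Definition prio_check : bool :=
  [&& ~~ lbl_eq P Q,
   (ALL x, [&& tri_ok P P x, tri_ok P Q x & lbl_eq (prio P x) P]),
   all_free (fun x => all_free (fun y =>
     (prio_rank x == prio_rank y =>> lbl_eq x y) && lbl_eq (prio x y) P)),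
   (ALL x, ALL y, tri_ok x y (prio x y)),
   (ALL x, ALL y, ALL x', ALL y', ~~ tri_ok x y (prio x' y') =>>
      prio_rank (prio x' y') <= prio_rank (prio x y) =>>
      ALL z, tri_ok x x' z =>> ~~ tri_ok y y' z),
   (ALL y, ALL z, ALL t, tri_ok y z t =>>
      ALL x, prio_rank (prio x z) <= prio_rank (prio (prio x y) t)),
   (ALL y, ALL y', ALL z, tri_ok y y' z =>> ALL x,
      (lbl_eq (prio x y') P =>> tri_ok (prio x y) P z) && tri_ok (prio x y) (prio x y') z) &
   (ALL x, ALL y, ALL x1, ALL y1', ALL z,
      ~~ tri_ok (prio x y) (prio x1 y1') z =>>
      ALL y1, prio_rank (prio x y) <= prio_rank (prio x1 y1) =>>
      ALL w, tri_ok x x1 w =>> tri_ok y y1 w =>>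
      ALL y', prio_rank (prio x1 y1') <= prio_rank (prio x y') =>>
      tri_ok y' y1' w =>> tri_ok y y' z =>> ~~ tri_ok y1 y1' z)].

Lemma tri_eq_swap t a b c : tri_eq t a b c = tri_eq t b a c.
Proof.
case: t => [[p q] r]; rewrite /tri_eq.
by repeat match goal with |- context [andb ?x ?y] => case: (andb x y) end.
Qed.

Lemma tri_eq_rot t a b c : tri_eq t a b c = tri_eq t b c a.
Proof.
case: t => [[p q] r]; rewrite /tri_eq.
by repeat match goal with |- context [andb ?x ?y] => case: (andb x y) end.
Qed.

Lemma tri_ok_swap a b c : tri_ok a b c = tri_ok b a c.
Proof. by apply: eq_all => t; rewrite tri_eq_swap. Qed.

Lemma tri_ok_rot a b c : tri_ok a b c = tri_ok b c a.
Proof. by apply: eq_all => t; rewrite tri_eq_rot. Qed.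

Lemma all_freeP (f : pred L) l : all_free f ->
  l = P \/ (exists x y, l = prio x y) -> f l.
Proof.
move=> /andP[fP fF] [->//|[x [y ->]]].
exact: els_complete (els_complete fF x) y.
Qed.

Lemma condP (a b : bool) : (a =>> b) -> a -> b.
Proof. by case: a. Qed.

Lemma prio_rule : prio_check -> exists K : amalgam_rule L, ok K = tri_ok.
Proof.
case/and5P=> /lbl_eqP PQ c2 c3 c4 /and4P[c5 c6 c7 c8].
have e2 x := and3P (els_complete c2 x).
unshelve eexists (@AmalgamRule L tri_ok P Q prio prio_rank _ _ _ _ _ _ _ _ _ _ _ _ _ _ _ _) => //.
- exact: tri_ok_swap.
- exact: tri_ok_rot.
- by move=> x; case: (e2 x).
- by move=> x; case: (e2 x).
- by move=> x y; rewrite /prio !(tri_ok_swap x y).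
- by move=> x; case: (e2 x) => _ _ /lbl_eqP.
- move=> x; rewrite /prio_rank (introT (lbl_eqP _ _) erefl).
  by case: ifP => //; case: ifP.
- move=> x y fx fy /eqP rxy.
  by have /andP[/condP /(_ rxy)/lbl_eqP] := all_freeP (all_freeP c3 fx) fy.
- move=> x y fx fy.
  by have /andP[_ /lbl_eqP] := all_freeP (all_freeP c3 fx) fy.
- by move=> x y; exact: els_complete (els_complete c4 x) y.
- move=> x y x' y' z o1 o2 le; apply: contraT => nok.
  have := els_complete (els_complete (els_complete (els_complete c5 x) y) x') y'.
  by move=> /condP/(_ nok)/condP/(_ le)/els_complete/(_ z); rewrite o1 o2.
- move=> x y z t o.
  have := els_complete (els_complete (els_complete c6 y) z) t.
  by move=> /condP/(_ o)/els_complete/(_ x).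
- move=> x y y' z o /lbl_eqP e.
  have := els_complete (els_complete (els_complete c7 y) y') z.
  by move=> /condP/(_ o)/els_complete/(_ x)/andP[]; rewrite e.
- move=> x y y' z o.
  have := els_complete (els_complete (els_complete c7 y) y') z.
  by move=> /condP/(_ o)/els_complete/(_ x)/andP[].
move=> x y y' x1 y1 y1' w z o1 o2 o3 o4 o5 l1 l2.
apply: contraT => nok; have := els_complete (els_complete (els_complete c8 x) y) x1.
move=> h; have {h} := els_complete (els_complete h y1') z.
move=> /condP/(_ nok)/els_complete/(_ y1)/condP/(_ l1)/els_complete/(_ w)/condP/(_ o1).
by move=> /condP/(_ o2)/els_complete/(_ y')/condP/(_ l2); rewrite o3 o4 o5.
Qed.

Lemma prio_simple (M : lstructure L) :
  prio_check -> is_fraisse_limit (Forb_c S) M -> simple_group (Aut M).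
Proof.
move=> /prio_rule[K okK] limM.
have okS a b c : ok K a b c <-> forall t, List.In t S -> ~ same_triangle t a b c.
  by rewrite okK; exact: tri_okP.
have [col genM] := limit_generic okS limM.
by apply: (generic_simple genM); case: limM.
Qed.
End PriorityRule.

(** * Verification for the listed sets *)

Lemma all_In (T : Type) (f : pred T) s : all f s -> forall x, List.In x s -> f x.
Proof. by elim: s => //= y s IHs /andP[fy /IHs h] x [<-|/h]. Qed.

Definition rgx_code (x : RGX.symbol) :=
  match x with RGX.R => 0 | RGX.G => 1 | RGX.X => 2 end.

Definition rgx_labels := [:: RGX.R; RGX.G; RGX.X].

Definition rgxy_code (x : RGXY.symbol) :=
  match x with RGXY.R => 0 | RGXY.G => 1 | RGXY.X => 2 | RGXY.Y => 3 end.

Definition rgxy_labels := [:: RGXY.R; RGXY.G; RGXY.X; RGXY.Y].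

(* The third label is used only by #26, whose limit is the metrically homogeneous
   graph of diameter 4 with X, Y, R, G for the distances 1, 2, 3, 4. *)
Lemma catalogue_check :
  all (fun S =>
    if prio_check rgxy_labels rgxy_code S RGXY.R RGXY.G RGXY.Y then true
    else prio_check rgxy_labels rgxy_code S RGXY.G RGXY.R RGXY.Y) RGXY.catalogue.
Proof. by vm_compute. Qed.

Theorem theorem1p4 :
  (forall M : lstructure RGX.symbol,
     is_fraisse_limit (Forb_c RGX.S) M -> simple_group (Aut M)) /\
  (forall S : seq (triangle RGXY.symbol), List.In S RGXY.catalogue ->
   forall M : lstructure RGXY.symbol,
     is_fraisse_limit (Forb_c S) M -> simple_group (Aut M)).
Proof.
split=> [M|S /(all_In catalogue_check) chk M].
  (* [R] is refused only between two edges labelled [X], and there [G] is allowed. *)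
  apply: (@prio_simple _ rgx_labels rgx_code _ _ _ RGX.R RGX.G RGX.X).
  - by move=> f /and4P[? ? ? _] [].
  - by move=> [] [].
  by vm_compute.
have els f : all f rgxy_labels -> forall x, f x by move=> /and5P[? ? ? ? _] [].
have inj : injective rgxy_code by move=> [] [].
(* Where [RRX] is forbidden [R] cannot be the top label, and [G] comes first. *)
move: chk; case: ifP => [chk _|_ chk]; exact: (prio_simple els inj chk).
Qed.
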